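(* Let $X$ be a reflexive Banach space and $Y$ a Banach space, let $\Theta:X\to(-\infty,\infty]$ be a proper, lower semi-continuous, $p$-convex function with $p\ge 2$ (with constant $\gamma$), let $\{\alpha_n\}$ be a sequence with $\alpha_n>0$, $1\le \alpha_n/\alpha_{n+1}\le\theta$ and $\lim_{n\to\infty}\alpha_n=0$ for some constant $\theta>1$, and let $F$ satisfy conditions (a)--(d) of the context and be weakly closed. Assume that $$\left(p^*\gamma\mu+2\gamma^{\frac{p}{p-1}}\right)\|\xi_0-\xi^\dagger\|^{\frac1{p-1}}<\rho$$ and that $\mathcal E:=(K_0+K_1)\|\xi_0-\xi^\dagger\|^{\frac1{p-1}}$ is sufficiently small. Let the iteration $\{x_n^\delta\}$ be terminated by either Rule 1, Rule 2 or Rule 3 (see context) with $\tau>1$, giving the integer $n_\delta$. Then for any sequence $\{y^{\delta_k}\}$ satisfying $\|y^{\delta_k}-y\|\le\delta_k$ with $\delta_k\to0$ as $k\to\infty$, $\{x_{n_{\delta_k}}^{\delta_k}\}$ has a subsequence that converges weakly in $X$ to a solution of $F(x)=y$ in $\overline{B_\rho(x^\dagger)}\cap D(F)$. If $x^\dagger$ is the unique solution of $F(x)=y$ in $\overline{B_\rho(x^\dagger)}\cap D(F)$, then $x_{n_\delta}^\delta$ converges weakly in $X$ to $x^\dagger$ as $\delta\to0$.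
   Context: All spaces are real; $\|\cdot\|$ denotes the norms of $X$, $Y$ and the dual norm of $X^*$; $\langle\xi,x\rangle=\xi(x)$ for $\xi\in X^*$, $x\in X$. Convexity. For a proper convex $\Theta:X\to(-\infty,\infty]$: $D(\Theta)=\{x:\Theta(x)<\infty\}$; $\partial\Theta(x)=\{\xi\in X^*:\Theta(z)-\Theta(x)-\langle\xi,z-x\rangle\ge0\ \forall z\in X\}$; $D(\partial\Theta)=\{x\in D(\Theta):\partial\Theta(x)\neq\emptyset\}$; for $\xi\in\partial\Theta(x)$ the Bregman distance is $D_\xi\Theta(z,x)=\Theta(z)-\Theta(x)-\langle\xi,z-x\rangle$. $\Theta$ is $p$-convex ($p\ge2$) if there is $C_0>0$ with $\Theta(\lambda z+(1-\lambda)x)+C_0\lambda(1-\lambda)\|z-x\|^p\le\lambda\Theta(z)+(1-\lambda)\Theta(x)$ for all $x,z\in X$, $\lambda\in(0,1)$; equivalently, there is $\gamma>0$ with $\|z-x\|\le\gamma[D_\xi\Theta(z,x)]^{1/p}$ for all $z\in X$, $x\in D(\partial\Theta)$, $\xi\in\partial\Theta(x)$. Such a constant $\gamma$ is fixed. $p^*$ is the conjugate exponent, $1/p+1/p^*=1$. Operator. $F:D(F)\subset X\to Y$ is a (nonlinear) operator, $y\in Y$, $B_\rho(x^\dagger)=\{x\in X:\|x-x^\dagger\|<\rho\}$. Conditions on $F$: (a) $D(F)$ is closed and convex in $X$ and $F(x)=y$ has a solution $x^\dagger\in D(F)\cap D(\partial\Theta)$; (b) there is $\rho>0$ such that for each $x\in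 B_\rho(x^\dagger)\cap D(F)$ there is a bounded linear operator $F'(x):X\to Y$ with $\lim_{t\searrow0}\frac{F(x+t(z-x))-F(x)}{t}=F'(x)(z-x)$ for all $z\in B_\rho(x^\dagger)\cap D(F)$; (c) $T:=F'(x^\dagger)$ satisfies $\|T\|\le\alpha_0^{1/p}/\gamma$; (d) there are constants $K_0,K_1\ge0$ with $\|[F'(z)-F'(x)]w\|\le K_0\|z-x\|\,\|F'(x)w\|+K_1\|F'(x)(z-x)\|\,\|w\|$ for all $w\in X$ and $x,z\in B_\rho(x^\dagger)\cap D(F)$. $F$ is weakly closed if $x_k\in D(F)$, $x_k\rightharpoonup x$ weakly in $X$ and $F(x_k)\rightharpoonup v$ weakly in $Y$ imply $x\in D(F)$ and $F(x)=v$. Method. $\Theta_F(x)=\Theta(x)$ if $x\in D(F)$ and $+\infty$ otherwise. Given $\xi_0\in X^*$, $x_0:=\nabla\Theta_F^*(\xi_0)$ ($\Theta_F^*$ the Fenchel conjugate), i.e. $x_0$ is the unique minimizer of $\Theta_F(x)-\langle\xi_0,x\rangle$ over $X$, so $\xi_0\in\partial\Theta_F(x_0)$. $\xi^\dagger\in\partial\Theta_F(x^\dagger)$ is the unique element of $\partial\Theta_F(x^\dagger)$ with $\|\xi_0-\xi^\dagger\|$ equal to the distance from $\xi_0$ to $\partial\Theta_F(x^\dagger)$. For $\delta>0$ and $y^\delta\in Y$ with $\|y^\delta-y\|\le\delta$, set $x_0^\delta:=x_0$ and let $x_{n+1}^\delta$ be the unique minimizer over $x\in X$ of $$\|y^\delta-F(x_n^\delta)-F'(x_n^\delta)(x-x_n^\delta)\|^p+\alpha_nD_{\xi_0}\Theta_F(x,x_0)$$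 (meaningful as long as $x_n^\delta\in B_\rho(x^\dagger)\cap D(F)$). Stopping rules, for given $\tau>1$. Rule 1: $n_\delta$ is the integer with $\|F(x_{n_\delta}^\delta)-y^\delta\|\le\tau\delta<\|F(x_n^\delta)-y^\delta\|$ for $0\le n<n_\delta$. Rule 2: if $\|F(x_0)-y^\delta\|\le\tau\delta$ then $n_\delta=0$; otherwise $n_\delta\ge1$ is the first integer with $\frac12(\|F(x_{n_\delta}^\delta)-y^\delta\|+\|F(x_{n_\delta-1}^\delta)-y^\delta\|)\le\tau\delta$. Rule 3: if $\|F(x_0)-y^\delta\|\le\tau\delta$ then $n_\delta=0$; otherwise $n_\delta\ge2$ is the first integer with $\max\{\|F(x_{n_\delta}^\delta)-y^\delta\|,\|F(x_{n_\delta-1}^\delta)-y^\delta\|\}\le\tau\delta$. The number $\mu>0$ is fixed, chosen depending only on $p,\gamma,\theta,\tau$, so that $\gamma^{\frac1{p-1}}\theta^{\frac2p}\mu^{-1}<\frac{\tau-1}2$. ''Sufficiently small'' means: smaller than a positive threshold depending only on $p,\gamma,\theta,\tau,\mu$ (not on $n$, $\delta$, $y^\delta$). *)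

(* Defs.v *)
From HB Require Import structures.
From mathcomp Require Import all_boot all_order all_algebra.
From mathcomp Require Import all_classical all_reals all_analysis.

Set Implicit Arguments.
Unset Strict Implicit.
Unset Printing Implicit Defensive.

Import Order.TTheory GRing.Theory Num.Theory.
Import numFieldNormedType.Exports.

Local Open Scope classical_set_scope.
Local Open Scope ring_scope.

Definition bounded_linear {R : realType} {V W : normedModType R} :
    {pred V -> W} :=
  [pred f | `[< linear f /\ exists M : R, forall x, `|f x| <= M * `|x| >]].

(* The space L(V, W) of bounded linear operators; below it is made a normed
   module for the operator norm. *)
Record bounded_op {R : realType} (V W : normedModType R) := BoundedOp {
  bounded_op_fun :> V -> W;
  _ : bounded_op_fun \in bounded_linear }.

Section bounded_op_lmodule.
Context {R : realType} {V W : normedModType R}.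

Lemma bounded_linearP (f : V -> W) :
  reflect (linear f /\ exists M : R, forall x, `|f x| <= M * `|x|)
    (f \in bounded_linear).
Proof. exact: asboolP. Qed.

Lemma bounded_linear_submod_closed : submod_closed (@bounded_linear R V W).
Proof.
split.
  apply/bounded_linearP; split; first by move=> a u v /=; rewrite scaler0 addr0.
  by exists 0 => x; rewrite normr0 mul0r.
move=> a f g /bounded_linearP[lf [Mf Hf]] /bounded_linearP[lg [Mg Hg]].
apply/bounded_linearP; split.
  move=> b u v; rewrite !fctE lf lg !scalerDr !scalerA (mulrC a b) -!addrA.
  by congr (_ + _); rewrite addrCA.
exists (`|a| * Mf + Mg) => x; rewrite !fctE mulrDl.
rewrite (le_trans (ler_normD _ _)) // lerD // normrZ -mulrA.
by rewrite ler_wpM2l.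
Qed.

HB.instance Definition _ :=
  GRing.isSubmodClosed.Build R (V -> W) bounded_linear
    bounded_linear_submod_closed.

HB.instance Definition _ := [isSub for @bounded_op_fun R V W].
HB.instance Definition _ := [Choice of bounded_op V W by <:].
HB.instance Definition _ := [SubChoice_isSubLmodule of bounded_op V W by <:].

Lemma bounded_op_is_linear (f : bounded_op V W) : linear f.
Proof. by case: f => f /= /bounded_linearP[]. Qed.

HB.instance Definition _ (f : bounded_op V W) :=
  GRing.isLinear.Build R V W _ f (bounded_op_is_linear f).

Definition op_norm (f : bounded_op V W) : R :=
  sup [set `|f x| | x in [set x : V | `|x| <= 1]].

Lemma op_norm_has_sup (f : bounded_op V W) :
  has_sup [set `|f x| | x in [set x : V | `|x| <= 1]].
Proof.
split; first by exists `|f 0|, 0 => //=; rewrite normr0.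
have [_ [M HM]] : linear f /\ exists M : R, forall x, `|f x| <= M * `|x|.
  by case: f => f /= /bounded_linearP.
exists (Num.max M 0) => _ [x /= x1 <-]; apply: le_trans (HM x) _.
apply: (@le_trans _ _ (Num.max M 0 * `|x|)).
  by rewrite ler_wpM2r // le_max lexx.
by rewrite ler_piMr // le_max lexx orbT.
Qed.

Lemma op_norm_ub (f : bounded_op V W) x : `|x| <= 1 -> `|f x| <= op_norm f.
Proof.
move=> x1; have [_ ub] := op_norm_has_sup f.
by apply: (ub_le_sup ub); exists x.
Qed.

Lemma op_norm_ge0 (f : bounded_op V W) : 0 <= op_norm f.
Proof.
by apply: le_trans (@op_norm_ub f 0 _); rewrite ?normr0 ?normr_ge0.
Qed.

Lemma op_norm_le (f : bounded_op V W) (M : R) :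
  (forall x, `|x| <= 1 -> `|f x| <= M) -> op_norm f <= M.
Proof.
move=> H; have [ne _] := op_norm_has_sup f.
by apply: ge_sup => // _ [x /= x1 <-]; exact: H.
Qed.

Lemma ler_op_norm (f : bounded_op V W) x : `|f x| <= op_norm f * `|x|.
Proof.
have [->|x0] := eqVneq x 0; first by rewrite linear0 !normr0 mulr0.
have nx : 0 < `|x| by rewrite normr_gt0.
have := @op_norm_ub f (`|x|^-1 *: x).
rewrite linearZ /= !normrZ normfV normr_id mulVf ?gt_eqF //.
by move=> /(_ (lexx _)); rewrite ler_pdivrMl // mulrC.
Qed.

Lemma op_normD (f g : bounded_op V W) :
  op_norm (f + g) <= op_norm f + op_norm g.
Proof.
apply: op_norm_le => x x1; rewrite (le_trans (ler_normD _ _)) //.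
by rewrite lerD // op_norm_ub.
Qed.

Lemma op_normZ (a : R) (f : bounded_op V W) :
  op_norm (a *: f) = `|a| * op_norm f.
Proof.
have le b (g : bounded_op V W) : op_norm (b *: g) <= `|b| * op_norm g.
  apply: op_norm_le => x x1.
  by rewrite [leLHS]normrZ ler_wpM2l // op_norm_ub.
apply/eqP; rewrite eq_le le /=.
have [->|a0] := eqVneq a 0; first by rewrite normr0 mul0r op_norm_ge0.
have := le a^-1 (a *: f); rewrite scalerA mulVf // scale1r normfV.
by rewrite ler_pdivlMl // normr_gt0.
Qed.

Lemma op_norm0_eq0 (f : bounded_op V W) : op_norm f = 0 -> f = 0.
Proof.
move=> f0; apply/val_inj/funext => x /=.
by apply/eqP; rewrite -normr_le0 (le_trans (ler_op_norm f x)) // f0 mul0r.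
Qed.

HB.instance Definition _ := Lmodule_isNormed.Build R (bounded_op V W)
  op_normD op_normZ op_norm0_eq0.

End bounded_op_lmodule.

Definition dual {R : realType} (X : normedModType R) : normedModType R :=
  bounded_op X R^o.

(* Surjectivity of the canonical embedding of X into its bidual. *)
Definition reflexive_space {R : realType} (X : normedModType R) : Prop :=
  forall phi : dual (dual X), exists x : X, forall xi : dual X, phi xi = xi x.

Definition weak_cvg {R : realType} {X : normedModType R}
    (G : set_system X) (x : X) : Prop :=
  forall xi : dual X, xi @ G --> xi x.

Section convexity.
Context {R : realType} {X : normedModType R}.
Implicit Types (Th : X -> \bar R) (p gam : R) (x z : X) (xi : dual X).
Local Open Scope ereal_scope.

Definition eproper Th : Prop :=
  (forall x, Th x != -oo) /\ (exists x, Th x < +oo).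

Definition edom Th : set X := [set x | Th x < +oo].

(* Meaningful when Th x is finite; the value is then +oo wherever Th z = +oo. *)
Definition bregman Th xi z x : \bar R := Th z - Th x - (xi (z - x)%R : R)%:E.

Definition subdiff Th x : set (dual X) :=
  [set xi | edom Th x /\ forall z, 0 <= bregman Th xi z x].

Definition dom_subdiff Th : set X :=
  [set x | edom Th x /\ subdiff Th x !=set0].

Definition p_convex Th p : Prop :=
  exists2 C0 : R, (0 < C0)%R &
    forall (x z : X) (lam : R), (0 < lam < 1)%R ->
      Th (lam *: z + (1 - lam) *: x)%R +
        (C0 * lam * (1 - lam) * `|z - x| `^ p)%:E
      <= lam%:E * Th z + (1 - lam)%:E * Th x.

Definition bregman_const Th p gam : Prop :=
  forall x z xi, dom_subdiff Th x -> subdiff Th x xi ->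
    `|z - x|%:E <= gam%:E * bregman Th xi z x `^ p^-1.

Definition unique_minimizer (J : X -> \bar R) x : Prop :=
  (forall z, J x <= J z) /\
  (forall x', (forall z, J x' <= J z) -> x' = x).

End convexity.

Section operator.
Context {R : realType} {X Y : normedModType R}.
Implicit Types (DF : set X) (F : X -> Y) (dF : X -> bounded_op X Y).

(* A partial operator F : D(F) -> Y is a total function F together with its
   domain DF; likewise dF x is meaningful only for x in ball xd rho `&` DF. *)
Definition restrict_ext (Th : X -> \bar R) DF : X -> \bar R :=
  fun x => if x \in DF then Th x else +oo%E.

Definition dir_derivable DF F dF (xd : X) (rho : R) : Prop :=
  forall x z, (ball xd rho `&` DF) x -> (ball xd rho `&` DF) z ->
    t^-1 *: (F (x + t *: (z - x)) - F x) @[t --> (0 : R)^'+] --> dF x (z - x).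

Definition nonlinearity_cond DF dF (xd : X) (rho K0 K1 : R) : Prop :=
  forall (w x z : X), (ball xd rho `&` DF) x -> (ball xd rho `&` DF) z ->
    `|(dF z - dF x) w| <=
      K0 * `|z - x| * `|dF x w| + K1 * `|dF x (z - x)| * `|w|.

Definition weakly_closed DF F : Prop :=
  forall (u : nat -> X) (x : X) (v : Y), (forall k, DF (u k)) ->
    weak_cvg (u @ \oo) x -> weak_cvg ((F \o u) @ \oo) v -> DF x /\ F x = v.

Definition LM_functional (Th : X -> \bar R) DF F dF (p a : R) (xi0 : dual X)
    (x0 : X) (yd : Y) (xn x : X) : \bar R :=
  ((`|yd - F xn - dF xn (x - xn)| `^ p)%:E +
     a%:E * bregman (restrict_ext Th DF) xi0 x x0)%E.

(* The recursion is only required at those n for which x_n lies in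
   B_rho(xd) `&` D(F), i.e. as long as the method is meaningful. *)
Definition LM_iteration (Th : X -> \bar R) DF F dF (p : R) (alpha : nat -> R)
    (xd : X) (rho : R) (xi0 : dual X) (x0 : X) (yd : Y) (u : nat -> X) : Prop :=
  u 0%N = x0 /\
  forall n, (ball xd rho `&` DF) (u n) ->
    unique_minimizer (LM_functional Th DF F dF p (alpha n) xi0 x0 yd (u n))
      (u n.+1).

End operator.

Definition unique_nearest {R : realType} {V : normedModType R}
    (A : set V) (v0 v : V) : Prop :=
  let at_dist w := A w /\ `|v0 - w| = inf [set `|v0 - a| | a in A] in
  at_dist v /\ forall w, at_dist w -> w = v.

Inductive stopping_rule := Rule1 | Rule2 | Rule3.

Section stopping.
Context {R : realType}.
(* res n is the residual |F(x_n) - yd| *)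
Implicit Types (tau delta : R) (res : nat -> R).

Definition first_from (m : nat) (P : nat -> Prop) (N : nat) : Prop :=
  [/\ (m <= N)%N, P N & forall n, (m <= n < N)%N -> ~ P n].

Definition stops (rule : stopping_rule) tau delta res (N : nat) : Prop :=
  match rule with
  | Rule1 => res N <= tau * delta /\ forall n, (n < N)%N -> tau * delta < res n
  | Rule2 =>
      if res 0%N <= tau * delta then N = 0%N else
      first_from 1
        (fun n => 2^-1 * (res n + res n.-1) <= tau * delta) N
  | Rule3 =>
      if res 0%N <= tau * delta then N = 0%N else
      first_from 2
        (fun n => Num.max (res n) (res n.-1) <= tau * delta) N
  end.

End stopping.

(* Main.v *)
Require Import Defs.
From mathcomp Require Import all_boot all_order all_algebra.
From mathcomp Require Import all_classical all_reals all_analysis.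
From mathcomp Require Import ring lra.

(** Write [E = |xi0 - xid| ^ (1/(p-1))], [g = gam ^ (1/(p-1))] and
    [a n = alpha n ^ (1/p)], and let [T] be the derivative at [xd].

    Comparing the minimiser [x_(n+1)] of a step with [xd], and moving the base
    point of the Bregman distance from [(x0, xi0)] to [(xd, xid)], gives
    [r^p + (a n)^p D^p <= s^p + (a n)^p (g E)^(p-1) D], where
    [D = |x_(n+1) - xd| / gam], [r] is the linearised residual at [x_(n+1)] and
    [s] the one at [xd]. Superadditivity of the power [p] turns this into
    [|x_(n+1) - xd| <= gam (s / a n + g E)] and [r <= s + a n g E] ([LM_step]).
    The nonlinearity condition bounds [s] by [delta] plus a small multiple of
    [|T (x_n - xd)|] ([linearization_error]). By induction, as long as
    [delta <= mu E a n], the iterates satisfy [|x_n - xd| <= C E < rho] and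
    [|T (x_n - xd)| <= B E a n] ([controlled_step]). At the first index where
    [mu E a n <= delta], and at its predecessor, the bound
    [gam ^ (1/(p-1)) theta ^ (2/p) / mu < (tau - 1) / 2] makes the residual at
    most [tau delta] once [(K0 + K1) E] is small, so each rule has stopped by then, with residual at most
    [2 tau delta] ([stopped_iterate]). Hence [F] of the stopped iterates tends
    to [y] while they stay in a ball of radius less than [rho]; weak sequential
    compactness ([reflexive_weak_subseq]) and weak closedness of [F] conclude.
    The second claim follows from the first by contradiction.

    One point of the comparison is delicate: [xid] is a subgradient of the
    restriction of [Th] to [DF], whereas the constant [gam] is only known for
    subgradients of [Th], and the sum rule for subdifferentials may fail without
    a qualification condition. [bregman_restrict_ge] transfers the inequality
    with the same constant: on the segment between two points of the domain, one
    uses nearby points at which [Th] itself has a subgradient, provided by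
    penalised minimisation and a sandwich argument ([approx_subgradient]). Both this and weak compactness rest on the
    Hahn-Banach theorem, obtained from minimal sublinear functionals. *)

Set Implicit Arguments.
Unset Strict Implicit.
Unset Printing Implicit Defensive.

Import Order.TTheory GRing.Theory Num.Theory.
Import numFieldNormedType.Exports.

Local Open Scope classical_set_scope.
Local Open Scope ring_scope.

(** * Sublinear functionals and the Hahn-Banach theorem *)

Section InfImage.
Context {R : realType} {I : Type}.
Implicit Types (P : set I) (f : I -> R).

Lemma inf_image_le P f (c : R) (i : I) :
  (forall j, P j -> c <= f j) -> P i -> inf [set f j | j in P] <= f i.
Proof.
move=> cf Pi; apply: ge_inf; last by exists i.
by exists c => _ [j Pj <-]; exact: cf.
Qed.

Lemma le_inf_image P f (c : R) (i : I) :
  P i -> (forall j, P j -> c <= f j) -> c <= inf [set f j | j in P].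
Proof.
move=> Pi cf; apply: lb_le_inf; first by exists (f i), i.
by move=> _ [j Pj <-]; exact: cf.
Qed.

End InfImage.

Section HahnBanach.
Context {R : realType} {V : lmodType R}.
Implicit Types (p q : V -> R) (x y : V).

(** Homogeneity is only asked as an inequality for positive scalars; equality
    for all nonnegative scalars follows. *)
Definition sublinear p : Prop :=
  (forall x y, p (x + y) <= p x + p y) /\
  (forall (a : R) x, 0 < a -> p (a *: x) <= a * p x).

Lemma sublinear0 p : sublinear p -> p 0 = 0.
Proof.
move=> [pD pZ]; apply/eqP; rewrite eq_le; apply/andP; split.
  have := pZ 2^-1 0 ltac:(lra); rewrite scaler0; lra.
by have := pD 0 0; rewrite addr0; lra.
Qed.

Lemma sublinearZ p (a : R) x : sublinear p -> 0 <= a -> p (a *: x) = a * p x.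
Proof.
move=> sp; rewrite le_eqVlt => /predU1P[<-|a0].
  by rewrite scale0r mul0r sublinear0.
case: (sp) => _ pZ; apply/eqP; rewrite eq_le pZ //=.
have := pZ a^-1 (a *: x); rewrite invr_gt0 => /(_ a0).
by rewrite scalerA mulVf ?gt_eqF // scale1r ler_pdivlMl.
Qed.

Lemma sublinear_geN p x : sublinear p -> - p (- x) <= p x.
Proof.
move=> sp; have [pD _] := sp; have := pD x (- x).
by rewrite subrr sublinear0 //; lra.
Qed.

(** The largest sublinear functional below [p] with value [- p y] at [- y]. *)
Definition sublinear_shift p y x : R :=
  inf [set p (x + t *: y) - t * p y | t in [set t : R | 0 <= t]].

Section Shift.
Variables (p : V -> R) (y : V).
Hypothesis sp : sublinear p.

Lemma shift_ge x (t : R) : 0 <= t -> - p (- x) <= p (x + t *: y) - t * p y.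
Proof.
move=> t0; rewrite -(sublinearZ y sp t0); have [pD _] := sp.
by have := pD (x + t *: y) (- x); rewrite addrAC subrr add0r; lra.
Qed.

Lemma shift_le x (t : R) : 0 <= t ->
  sublinear_shift p y x <= p (x + t *: y) - t * p y.
Proof.
by move=> t0; exact: (@inf_image_le _ _ _ _ (- p (- x)) t (shift_ge x)).
Qed.

Lemma shift_le_id x : sublinear_shift p y x <= p x.
Proof.
by apply: le_trans (shift_le x (lexx 0)) _; rewrite scale0r addr0 mul0r subr0.
Qed.

Lemma le_shift x (c : R) :
  (forall t : R, 0 <= t -> c <= p (x + t *: y) - t * p y) ->
  c <= sublinear_shift p y x.
Proof. by move=> H; apply: (@le_inf_image _ _ _ _ c 0) => //=; exact: lexx. Qed.

Lemma sublinear_shiftP : sublinear (sublinear_shift p y).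
Proof.
have [pD _] := sp; split.
  move=> x z; rewrite -lerBlDr; apply: le_shift => t t0.
  rewrite lerBlDr -lerBlDl; apply: le_shift => s s0.
  have := shift_le (x + z) (addr_ge0 t0 s0).
  have := pD (x + t *: y) (z + s *: y).
  rewrite addrACA -scalerDl; lra.
move=> a x a0; rewrite -ler_pdivrMl //; apply: le_shift => t t0.
rewrite ler_pdivrMl //.
have := shift_le (a *: x) (mulr_ge0 (ltW a0) t0).
by rewrite -scalerA -scalerDr (sublinearZ _ sp) ?(ltW a0) //; lra.
Qed.

End Shift.

(** A minimal sublinear functional equals each of its shifts, hence is linear;
    minimal ones exist because chains have pointwise infima. *)
Lemma minimal_sublinear q : sublinear q ->
  exists p, [/\ sublinear p, forall x, p x <= q x &
    forall p', sublinear p' -> (forall x, p' x <= p x) -> p' = p].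
Proof.
move=> sq.
pose T := {p : V -> R | sublinear p /\ forall x, p x <= q x}.
pose leT (s t : T) := `[< forall x, sval t x <= sval s x >].
have [] := @Zorn T leT.
- by move=> t; apply/asboolP.
- move=> r s t /asboolP rs /asboolP st; apply/asboolP => x.
  exact: le_trans (st x) (rs x).
- move=> [s Hs] [t Ht] /asboolP /= st /asboolP /= ts.
  apply: eq_exist => /=; apply/funext => x.
  by apply/eqP; rewrite eq_le ts st.
- move=> A Atot.
  have [A0|/set0P[a0 Aa0]] := eqVneq A set0.
    have Hq : sublinear q /\ forall x, q x <= q x by [].
    by exists (exist _ q Hq) => s; rewrite A0.
  pose m x : R := inf [set sval s x | s in A].
  have lb x s : A s -> - q (- x) <= sval s x.
    move=> As; case: (svalP s) => ss sle.
    by have := sublinear_geN x ss; have := sle (- x); lra.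
  have m_le x s : A s -> m x <= sval s x.
    by move=> As; exact: (@inf_image_le _ _ _ (fun s : T => sval s x) _ s (lb x)).
  have m_ge x c : (forall s, A s -> c <= sval s x) -> c <= m x.
    by move=> H; exact: (@le_inf_image _ _ _ _ c a0).
  have sm : sublinear m /\ forall x, m x <= q x.
    split; last first.
      by move=> x; apply: le_trans (m_le x _ Aa0) _; case: (svalP a0).
    split.
      move=> x y; rewrite -lerBlDr; apply: (m_ge) => s As.
      rewrite lerBlDr -lerBlDl; apply: (m_ge) => t At.
      have [/asboolP st|/asboolP ts] := Atot _ _ As At.
        have [[tD _] _] := svalP t.
        by have := tD x y; have := m_le (x + y) _ At; have := st x; lra.
      have [[sD _] _] := svalP s.
      by have := sD x y; have := m_le (x + y) _ As; have := ts y; lra.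
    move=> a x a_gt0; rewrite -ler_pdivrMl //; apply: (m_ge) => s As.
    rewrite ler_pdivrMl //; apply: le_trans (m_le _ _ As) _.
    by have [[_ sZ] _] := svalP s; exact: sZ.
  exists (exist _ m sm) => s As; apply/asboolP => x /=; exact: m_le.
move=> [p [sp pq]] pmin; exists p; split=> // p' sp' p'p.
have H : sublinear p' /\ forall x, p' x <= q x.
  by split=> // x; exact: le_trans (p'p x) (pq x).
have le_pp' : leT (exist _ p (conj sp pq)) (exist _ p' H) by apply/asboolP.
by have /(congr1 (fun t : T => sval t)) := pmin _ le_pp'.
Qed.

Lemma hahn_banach q : sublinear q ->
  exists2 f : V -> R, linear (f : V -> R^o) & forall x, f x <= q x.
Proof.
move=> /minimal_sublinear[p [sp pq pmin]]; exists p => //.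
have pD x y : p (x + y) = p x + p y.
  have [spD _] := sp; apply/eqP; rewrite eq_le spD /=.
  have shiftE : sublinear_shift p y = p.
    by apply: pmin; [exact: sublinear_shiftP | exact: shift_le_id].
  have := @shift_le p y sp x 1 ler01; rewrite shiftE scale1r mul1r; lra.
have pN x : p (- x) = - p x.
  by apply/eqP; rewrite -addr_eq0 -pD addNr sublinear0.
move=> a x y; rewrite pD; congr (_ + _).
have [a0|a0] := leP 0 a; first exact: sublinearZ.
have -> : a *: x = - (- a *: x) by rewrite scaleNr opprK.
by rewrite pN sublinearZ ?oppr_ge0 ?(ltW a0) // mulNr opprK.
Qed.

(** Applying [hahn_banach] to the shift along [x0] forces equality at [x0]. *)
Lemma hahn_banach_at q x0 : sublinear q ->
  exists f : V -> R, [/\ linear (f : V -> R^o), forall x, f x <= q x &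
    f x0 = q x0].
Proof.
move=> sq; have [f lf fq] := hahn_banach (sublinear_shiftP x0 sq).
have fle x : f x <= q x by apply: le_trans (fq x) (shift_le_id _ sq _).
exists f; split=> //; apply/eqP; rewrite eq_le fle /=.
have := le_trans (fq (- x0)) (@shift_le _ x0 sq (- x0) 1 ler01).
rewrite scale1r addNr sublinear0 // mul1r.
have := lf (-1) x0 0; rewrite addr0 scaleN1r => ->.
have -> : f 0 = 0.
  have := lf 1 0 0; rewrite scale1r addr0 /=.
  by move/(congr1 (fun z => z - f 0)); rewrite scale1r subrr addrK.
by rewrite addr0 [_ *: _]mulN1r; lra.
Qed.

End HahnBanach.

(** * Bounded functionals *)

Section DualHahnBanach.
Context {R : realType} {X : normedModType R}.
Implicit Types (xi : dual X) (x : X).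

Lemma ler_dual_norm xi x : `|xi x : R| <= `|xi| * `|x|.
Proof. exact: (@ler_op_norm R X R^o xi x). Qed.

Lemma dualD xi x z : (xi (x + z) : R) = (xi x : R) + (xi z : R).
Proof. exact: linearD. Qed.

Lemma dualB xi x z : (xi (x - z) : R) = (xi x : R) - (xi z : R).
Proof. exact: linearB. Qed.

Lemma dualN xi x : (xi (- x) : R) = - (xi x : R).
Proof. exact: linearN. Qed.

Lemma dualZ xi (a : R) x : (xi (a *: x) : R) = a * (xi x : R).
Proof. exact: (linearZ_LR xi). Qed.

Lemma dual_hahn_banach (q : X -> R) (M : R) (x0 : X) :
  sublinear q -> (forall x, q x <= M * `|x|) ->
  exists xi : dual X, (forall x, (xi x : R) <= q x) /\ (xi x0 : R) = q x0.
Proof.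
move=> sq qM; have [f [lf fq fx0]] := hahn_banach_at x0 sq.
have fN x : f (- x) = - f x.
  have f0 : f 0 = 0.
    have := lf 1 0 0; rewrite scale1r addr0 /= => /(congr1 (fun z => z - f 0)).
    by rewrite scale1r subrr addrK.
  by have := lf (-1) x 0; rewrite addr0 scaleN1r f0 addr0 => ->; exact: mulN1r.
have fP : (f : X -> R^o) \in bounded_linear.
  apply/bounded_linearP; split=> //; exists M => x.
  rewrite ler_norml (le_trans (fq x) (qM x)) andbT.
  have := le_trans (fq (- x)) (qM (- x)); rewrite fN normrN; lra.
by exists (BoundedOp fP).
Qed.

Lemma sublinear_scaled_norm (c : R) : 0 <= c ->
  sublinear (fun x : X => c * `|x|).
Proof.
move=> c0; split=> [x z|a x a0]; first by rewrite -mulrDr ler_wpM2l // ler_normD.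
by rewrite normrZ (gtr0_norm a0) mulrCA.
Qed.

Lemma norming_functional (x0 : X) :
  exists xi : dual X, (forall x, `|xi x : R| <= `|x|) /\ (xi x0 : R) = `|x0|.
Proof.
have [xi [xile xix0]] := @dual_hahn_banach (fun x => 1 * `|x|) 1 x0
  (sublinear_scaled_norm ler01) (fun x => lexx _).
exists xi; split; last by rewrite xix0 mul1r.
move=> x; rewrite ler_norml; have := xile x; have := xile (- x).
by rewrite dualN normrN; lra.
Qed.

(** Mazur: if every functional vanishing on the subspace [M] vanishes at [x],
    then [x] lies in the closure of [M]. *)
Lemma annihilator_closure (M : set X) (x : X) :
  M 0 -> (forall y z, M y -> M z -> M (y + z)) ->
  (forall (a : R) y, M y -> M (a *: y)) ->
  (forall xi : dual X, (forall y, M y -> (xi y : R) = 0) -> (xi x : R) = 0) ->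
  forall e : R, 0 < e -> exists2 m, M m & `|x - m| < e.
Proof.
move=> M0 MD MZ Mx e e0.
pose d z : R := inf [set `|z - m| | m in M].
have d_le z m : M m -> d z <= `|z - m|.
  by move=> Mm; apply: (@inf_image_le _ _ _ (fun m => `|z - m|) 0).
have le_d z c : (forall m, M m -> c <= `|z - m|) -> c <= d z.
  by move=> H; apply: (@le_inf_image _ _ _ _ c 0).
have sd : sublinear d.
  split.
    move=> y z; rewrite -lerBlDr; apply: (le_d) => m Mm.
    rewrite lerBlDr -lerBlDl; apply: (le_d) => m' Mm'; rewrite lerBlDl.
    apply: le_trans (d_le _ _ (MD _ _ Mm Mm')) _.
    by apply: le_trans (ler_normD _ _); rewrite opprD addrACA.
  move=> a z a0; rewrite -ler_pdivrMl //; apply: (le_d) => m Mm.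
  rewrite ler_pdivrMl // -[in leRHS](gtr0_norm a0) -normrZ scalerBr.
  by apply: d_le; exact: MZ.
have dM z : d z <= 1 * `|z|.
  by rewrite mul1r; have := d_le z 0 M0; rewrite subr0.
have [xi [xid xix]] := dual_hahn_banach x sd dM.
have d0 y : M y -> d y <= 0.
  by move=> My; have := d_le y y My; rewrite subrr normr0.
have dx0 : d x = 0.
  rewrite -xix; apply: Mx => y My; apply/eqP; rewrite eq_le.
  rewrite (le_trans (xid y) (d0 y My)) /=.
  have MyN : M (- y) by rewrite -scaleN1r; exact: MZ.
  by have := le_trans (xid (- y)) (d0 _ MyN); rewrite dualN; lra.
apply/not_exists2P => H; suff : e <= d x by rewrite dx0; lra.
by apply: le_d => m Mm; case: (H m) => // /negP; rewrite -leNgt.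
Qed.

End DualHahnBanach.

(** * Weak sequential compactness in reflexive spaces *)

Section WeakCompactness.
Context {R : realType} {X : normedModType R}.

Lemma ultra_bounded_cvg (I : Type) (G : set_system I) (f : I -> R) (M : R) :
  UltraFilter G -> (forall i, `|f i| <= M) -> exists l : R, f @ G --> l.
Proof.
move=> UG fM.
have [|l [_ lcl]] := @segment_compact R (- M) M (f @ G) _.
  rewrite /fmap /=; apply: filterS filterT => i _ /=.
  by rewrite in_itv /= -ler_norml.
exists l => A Al; rewrite /= /fmap /=.
have [//|GA] := in_ultra_setVsetC (f @^-1` A) UG.
by have [z [/= nAz Az]] := lcl (~` A) A GA Al.
Qed.

(** Along an ultrafilter every bounded family of a reflexive space has a weak
    limit: the limits of the values of functionals form an element of the
    bidual. *)
Lemma ultra_weak_cvg (I : Type) (G : set_system I) (v : I -> X) (M : R) :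
  reflexive_space X -> UltraFilter G -> (forall i, `|v i| <= M) ->
  exists x : X, forall xi : dual X,
    (fun i => xi (v i) : R) @ G --> (xi x : R).
Proof.
move=> reflX UG vM.
have M0 (xi : dual X) i : `|xi (v i) : R| <= `|xi| * M.
  by apply: le_trans (ler_dual_norm _ _) _; rewrite ler_wpM2l.
have /choice[phi phiP] : forall xi : dual X, exists l : R,
    (fun i => xi (v i) : R) @ G --> l.
  by move=> xi; exact: ultra_bounded_cvg UG (M0 xi).
have phil : linear (phi : dual X -> R^o).
  move=> a xi zeta; apply: cvg_unique (phiP _) _ => //.
  by apply: cvgD (phiP zeta); apply: cvgMr; exact: phiP.
have phib : (phi : dual X -> R^o) \in bounded_linear.
  apply/bounded_linearP; split=> //; exists M => xi; rewrite mulrC.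
  have cn : (fun i => `|xi (v i) : R|) @ G --> `|phi xi|.
    by apply: cvg_norm; exact: phiP.
  by apply: (cvgr_to_le cn); apply: nearW => i; exact: M0.
have [x xP] := reflX (BoundedOp phib).
by exists x => xi; rewrite -xP; exact: phiP.
Qed.

(** Finite linear combinations of the terms of [u], coded by lists of pairs
    (coefficient, index): concatenation is addition, and the lists with rational
    coefficients are countably many. *)
Definition lincomb (u : nat -> X) (s : seq (R * nat)) : X :=
  \sum_(c <- s) c.1 *: u c.2.

Definition rat_lincomb (u : nat -> X) (s : seq (rat * nat)) : X :=
  lincomb u [seq (ratr c.1, c.2) | c <- s].

Lemma rat_lincomb_dense u s (e : R) : 0 < e ->
  exists s', `|lincomb u s - rat_lincomb u s'| < e.
Proof.
elim: s e => [|[a n] s IHs] e e0.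
  by exists [::]; rewrite /rat_lincomb /lincomb !big_nil subrr normr0.
have e2 : 0 < e / 2 by lra.
have [s' ss'] := IHs _ e2.
have un : 0 < `|u n| + 1 by have := normr_ge0 (u n); lra.
have [|r] := @rat_in_itvoo R a (a + e / 2 / (`|u n| + 1)) _.
  by rewrite ltrDl divr_gt0.
rewrite in_itv /= => /andP[ar ra].
exists ((r, n) :: s'); rewrite /rat_lincomb /lincomb map_cons !big_cons /=.
rewrite opprD addrACA -scalerBl (le_lt_trans (ler_normD _ _)) //.
rewrite [ltRHS](splitr e) ler_ltD // normrZ ltr0_norm; last by lra.
apply: (@le_trans _ _ (- (a - ratr r) * (`|u n| + 1))).
  by rewrite ler_wpM2l //; lra.
by rewrite -ler_pdivlMr //; lra.
Qed.

(** Countably many functionals separate the points of the closed span of [u]: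
    norming functionals of the rational combinations of the [u k]. *)
Lemma countable_separating (u : nat -> X) : exists xi : nat -> dual X,
  forall x : X,
    (forall zeta : dual X, (forall k, (zeta (u k) : R) = 0) ->
      (zeta x : R) = 0) ->
    (forall i, (xi i x : R) = 0) -> x = 0.
Proof.
have /choice[xi xiP] : forall i : nat, exists xi : dual X,
    (forall x, `|xi x : R| <= `|x|) /\
    (xi (rat_lincomb u (odflt [::] (unpickle i))) : R) =
      `|rat_lincomb u (odflt [::] (unpickle i))|.
  by move=> i; exact: norming_functional.
exists xi => x xann xix; apply/eqP; rewrite -normr_eq0; apply/negPn/negP => xn0.
have x0 : 0 < `|x| by rewrite lt0r xn0 normr_ge0.
have e0 : 0 < `|x| / 4 by lra.
have [_ [s _ <-] xs] : exists2 m, range (lincomb u) m & `|x - m| < `|x| / 4.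
  apply: annihilator_closure => //.
  - by exists [::] => //; rewrite /lincomb big_nil.
  - by move=> _ _ [s _ <-] [t _ <-]; exists (s ++ t) => //; rewrite /lincomb big_cat.
  - move=> a _ [s _ <-]; exists [seq (a * c.1, c.2) | c <- s] => //.
    rewrite /lincomb big_map scaler_sumr; apply: eq_bigr => c _ /=.
    by rewrite scalerA.
  - move=> zeta zM; apply: xann => k; apply: zM; exists [:: (1, k)] => //.
    by rewrite /lincomb big_seq1 scale1r.
have [s' ss'] := rat_lincomb_dense u s e0.
have [xin] := xiP (pickle s'); rewrite pickleK /= => xis.
set m := rat_lincomb u s' in ss' xis.
have := xin (m - x); rewrite dualB xix subr0 xis normr_id.
have := ler_distD (lincomb u s) m x.
rewrite (distrC m (lincomb _ _)) (distrC (lincomb _ _) x).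
have := ler_normD (x - m) m; rewrite subrK (distrC x m); lra.
Qed.

(** A sequential form of the Eberlein-Smulian theorem: the limit [x] is found
    first, along an ultrafilter, and the subsequence is chosen so that the
    countably many separating functionals converge to their values at [x]. *)
Lemma reflexive_weak_subseq (u : nat -> X) (M : R) :
  reflexive_space X -> (forall k, `|u k| <= M) ->
  exists (phi : nat -> nat) (x : X),
    {homo phi : i j / (i < j)%N} /\ weak_cvg ((u \o phi) @ \oo) x.
Proof.
move=> reflX uM.
have [xi xi_sep] := countable_separating u.
have [U [UU ooU]] := @ultraFilterLemma nat \oo _.
have [x xP] := ultra_weak_cvg reflX UU uM.
have xann (zeta : dual X) : (forall k, (zeta (u k) : R) = 0) -> (zeta x : R) = 0.
  move=> z0; apply: cvg_unique (xP zeta) _ => //.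
  by apply: cvg_near_cst; apply: nearW => i; exact: z0.
(* from index [nm.2] on, a term close to [x] for the first functionals *)
have next (nm : nat * nat) : exists k, (nm.2 < k)%N /\
    forall i : 'I_nm.1.+1,
      `|(xi i x : R) - (xi i (u k) : R)| < nm.1.+1%:R^-1.
  apply: (@filter_ex _ U); apply: filterI; first by apply: ooU; exact: nbhs_infty_gt.
  apply: filter_forall => i.
  have /cvgrPdist_lt := xP (xi i); apply.
  by rewrite invr_gt0 ltr0n.
have /choice[f fP] := next.
pose phi := fix phi n := if n is m.+1 then f (m.+1, phi m) else f (0, 0)%N.
have phiS n : (phi n < phi n.+1)%N by have [] := fP (n.+1, phi n).
have phiP n (i : nat) : (i <= n)%N ->
    `|(xi i x : R) - (xi i (u (phi n)) : R)| < n.+1%:R^-1.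
  rewrite -ltnS => iln; case: n iln => [|n] iln.
    by have [_ /(_ (Ordinal iln))] := fP (0, 0)%N.
  by have [_ /(_ (Ordinal iln))] := fP (n.+1, phi n).
have xiphi i : (fun n => xi i (u (phi n)) : R) @ \oo --> (xi i x : R).
  apply/cvgrPdist_lt => e e0; near=> n.
  apply: lt_trans (phiP n i _) _; first by near: n; exact: nbhs_infty_ge.
  by near: n; exact: near_infty_natSinv_lt (PosNum e0).
exists phi, x; split; first by apply: homo_ltn => // ? ? ?; exact: ltn_trans.
move=> zeta; apply/cvgrPdist_lt => e e0; apply/not_notP => nB.
pose B := [set n | e <= `|(zeta x : R) - (zeta (u (phi n)) : R)|].
(* an ultrafilter on which [zeta] stays away from [zeta x] gives a second weak
   limit, which the separating functionals cannot distinguish from [x] *)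
have PB : ProperFilter (within B \oo).
  split; last exact: within_filter.
  move=> B0; apply: nB; move: B0; rewrite /within /=.
  by apply: filterS => n /= nB; rewrite ltNge; apply/negP.
have [W [UW BW]] := ultraFilterLemma PB.
have ooW : \oo `<=` W.
  by move=> A ooA; apply: BW; apply: filterS ooA => n.
have [z zP] := @ultra_weak_cvg _ W (u \o phi) M reflX UW (fun k => uM _).
have zx : z = x.
  apply/eqP; rewrite -subr_eq0; apply/eqP; apply: xi_sep => [eta eta0|i].
    rewrite dualB (xann _ eta0) subr0; apply: cvg_unique (zP eta) _ => //.
    by apply: cvg_near_cst; apply: nearW => n; exact: eta0.
  rewrite dualB; apply/eqP; rewrite subr_eq0; apply/eqP.
  apply: cvg_unique (zP (xi i)) _ => //.
  by apply: cvg_trans (xiphi i); exact: cvg_app.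
have /cvgrPdist_lt /(_ e e0) := zP zeta; rewrite zx => We.
have : W B by apply: BW; rewrite /within /=; apply: nearW.
move=> /(filterI We) /filter_ex[n []] /=; rewrite /B /=; lra.
Unshelve. all: by end_near. Qed.

End WeakCompactness.

(** * Subgradients of uniformly convex functions *)

Section UniformlyConvex.
Context {R : realType} {X : completeNormedModType R}.
Variables (D : set X) (th : X -> R) (p C0 : R).
Hypotheses (p_gt0 : 0 < p) (C0_gt0 : 0 < C0).
Hypothesis th_convex : forall (x z : X) (lam : R), 0 < lam < 1 -> D x -> D z ->
  D (lam *: z + (1 - lam) *: x) /\
  th (lam *: z + (1 - lam) *: x) + C0 * lam * (1 - lam) * `|z - x| `^ p <=
    lam * th z + (1 - lam) * th x.
Hypothesis th_lsc : forall (v : nat -> X) (w : X) (m : R),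
  (forall n, D (v n)) -> v @ \oo --> w ->
  (forall e : R, 0 < e -> \forall n \near \oo, th (v n) <= m + e) ->
  D w /\ th w <= m.

(** Minimising sequences of [th + lam |. - xt|] are Cauchy by uniform
    convexity, so that no compactness is needed. *)
Lemma penalized_min (xt : X) (lam c : R) : D xt -> 0 <= lam ->
  (forall v, D v -> c <= th v + lam * `|v - xt|) ->
  exists2 w, D w &
    forall v, D v -> th w + lam * `|w - xt| <= th v + lam * `|v - xt|.
Proof.
move=> Dxt lam0 Gc; pose G v := th v + lam * `|v - xt|.
pose m := inf [set G v | v in D].
have m_le v : D v -> m <= G v.
  by move=> Dv; apply: (inf_image_le (f := G)) Gc Dv.
have near_m (n : nat) : exists v, D v /\ G v < m + n.+1%:R^-1.
  have hi : has_inf [set G v | v in D].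
    by split; [exists (G xt), xt|exists c => _ [v Dv <-]; exact: Gc].
  have n0 : 0 < n.+1%:R^-1 :> R by rewrite invr_gt0 ltr0n.
  by have [_ [v Dv <-] vm] := inf_adherent n0 hi; exists v.
have /choice[v vP] := near_m.
have Dv n : D (v n) by have [] := vP n.
have close a b (d : R) : D a -> D b -> G a < m + d -> G b < m + d ->
    C0 / 4 * `|a - b| `^ p < d.
  move=> Da Db Ga Gb; have [|Dc thc] := @th_convex b a 2^-1 _ Db Da.
    by apply/andP; split; lra.
  have := m_le _ Dc; rewrite /G in Ga Gb *.
  have : `|2^-1 *: a + (1 - 2^-1) *: b - xt| <= 2^-1 * `|a - xt| + 2^-1 * `|b - xt|.
    rewrite (_ : _ - xt = 2^-1 *: (a - xt) + 2^-1 *: (b - xt)); last first.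
      rewrite !scalerBr (_ : 1 - 2^-1 = 2^-1 :> R); last by lra.
      rewrite addrACA -opprD -scalerDl (_ : 2^-1 + 2^-1 = 1 :> R) ?scale1r //.
      by lra.
    rewrite (le_trans (ler_normD _ _)) // !normrZ.
    by rewrite (@gtr0_norm _ 2^-1) ?invr_gt0.
  move=> /(ler_wpM2l lam0); rewrite mulrDr.
  move: thc; lra.
have cauchy_v : cvg (v @ \oo).
  apply/cauchy_cvgP/cauchy_exP => e e0.
  have d0 : 0 < C0 / 4 * e `^ p by rewrite mulr_gt0 ?powR_gt0 ?divr_gt0.
  have [N _ NP] := near_infty_natSinv_lt (PosNum d0).
  have le_d n : (N <= n)%N -> G (v n) < m + C0 / 4 * e `^ p.
    move=> Nn; have [_ vn] := vP n; apply: lt_trans vn _.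
    by rewrite ltrD2l; exact: NP.
  exists (v N); rewrite /fmap /=; exists N => // n Nn; rewrite -ball_normE /=.
  have := close _ _ _ (Dv N) (Dv n) (le_d _ (leqnn N)) (le_d _ Nn).
  rewrite ltr_pM2l ?divr_gt0 // => lep; rewrite ltNge; apply/negP => le_e.
  have := ge0_ler_powR (ltW p_gt0) _ _ le_e.
  by rewrite !nnegrE normr_ge0 (ltW e0) => /(_ isT isT); rewrite leNgt lep.
set w := lim (v @ \oo) in cauchy_v.
have cn : (fun n => lam * `|v n - xt|) @ \oo --> lam * `|w - xt|.
  by apply: cvgMr; apply: cvg_norm; apply: cvgB => //; exact: cvg_cst.
have [//|//||Dw thw] := th_lsc (v := v) (w := w) (m := m - lam * `|w - xt|).
  move=> e e0; have e2 : 0 < e / 2 by lra.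
  have /cvgrPdist_lt /(_ _ e2) cn' := cn.
  near=> n; have [_ vm] := vP n; rewrite /G in vm.
  have : n.+1%:R^-1 < e / 2.
    by near: n; exact: (near_infty_natSinv_lt (PosNum e2)).
  have : `|lam * `|w - xt| - lam * `|v n - xt| | < e / 2 by near: n.
  rewrite ltr_norml => /andP[_ +]; move: vm; set r := _^-1; lra.
by exists w => // u Du; have := m_le u Du; rewrite /G; lra.
Unshelve. all: by end_near. Qed.

(** Sandwich theorem: an affine function lies between [m - lam |. - xt|] and
    [th]. *)
Lemma sandwich_norm (xt : X) (lam m : R) : D xt -> 0 <= lam ->
  (forall v, D v -> m <= th v + lam * `|v - xt|) ->
  exists zeta : dual X, (forall v, (zeta v : R) <= lam * `|v|) /\
    (forall v, D v -> m + (zeta (v - xt) : R) <= th v).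
Proof.
move=> Dxt lam0 mle.
pose f u (sv : R * X) := sv.1 * (th sv.2 - m) + lam * `|u - sv.1 *: (sv.2 - xt)|.
pose P := [set sv : R * X | 0 <= sv.1 /\ D sv.2].
pose q u := inf [set f u sv | sv in P].
have f_ge u sv : P sv -> - (lam * `|u|) <= f u sv.
  case: sv => s v [/= s0 Dv]; rewrite /f /=.
  have h : `|s *: (v - xt)| <= `|u| + `|u - s *: (v - xt)|.
    by have := ler_normB u (u - s *: (v - xt)); rewrite subKr.
  have := ler_wpM2l lam0 h; rewrite normrZ (ger0_norm s0).
  by have := ler_wpM2l s0 (mle v Dv); lra.
have q_le u sv : P sv -> q u <= f u sv.
  by move=> Psv; apply: (inf_image_le (f := f u)) (f_ge u) Psv.
have P0 : P (0, xt) by [].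
have le_q u c : (forall sv, P sv -> c <= f u sv) -> c <= q u.
  by move=> H; exact: (le_inf_image P0 H).
(* [q] is the infimal convolution of [lam] times the norm with the positively
   homogeneous hull of [th (xt + .) - m] *)
have q_norm u : q u <= lam * `|u|.
  apply: le_trans (q_le u _ P0) _.
  by rewrite /f /= mul0r add0r scale0r subr0.
(* the cone over the epigraph of [th (xt + .) - m] is closed under addition *)
have combine s1 v1 s2 v2 : 0 <= s1 -> D v1 -> 0 <= s2 -> D v2 ->
    exists v, [/\ D v, (s1 + s2) * (th v - m) <= s1 * (th v1 - m) + s2 * (th v2 - m)
     & (s1 + s2) *: (v - xt) = s1 *: (v1 - xt) + s2 *: (v2 - xt)].
  rewrite le_eqVlt => /predU1P[<- _ _ D2|s10 D1].
    by exists v2; rewrite !add0r mul0r scale0r !add0r.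
  rewrite le_eqVlt => /predU1P[<- _|s20 D2].
    by exists v1; rewrite !addr0 mul0r scale0r !addr0.
  have s0 : 0 < s1 + s2 by lra.
  have sn : s1 + s2 != 0 by rewrite gt_eqF.
  have l01 : 0 < s1 / (s1 + s2) < 1.
    by rewrite divr_gt0 //= ltr_pdivrMr // mul1r ltrDl.
  have [Dv thv] := th_convex l01 D2 D1.
  exists (s1 / (s1 + s2) *: v1 + (1 - s1 / (s1 + s2)) *: v2); split=> //.
    have {}thv : th (s1 / (s1 + s2) *: v1 + (1 - s1 / (s1 + s2)) *: v2) <=
        s1 / (s1 + s2) * th v1 + (1 - s1 / (s1 + s2)) * th v2.
      apply: le_trans thv; rewrite lerDl mulr_ge0 ?powR_ge0 //.
      case/andP: l01 => l0 l1; rewrite mulr_ge0 ?subr_ge0 ?(ltW l1) //.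
      by rewrite mulr_ge0 ?(ltW l0) // ltW.
    have := ler_wpM2l (ltW s0) thv.
    set T := th _; rewrite (_ : (s1 + s2) * (_ + _) = s1 * th v1 + s2 * th v2).
      by lra.
    by field.
  rewrite scalerBr scalerDr !scalerA mulrBr mulr1 (mulrC (s1 + s2)) divfK //.
  by rewrite [s1 + s2 - s1]addrC addKr !scalerBr [RHS]addrACA -opprD -scalerDl.
have sq : sublinear q.
  split.
    move=> u1 u2; rewrite -lerBlDr; apply: (le_q) => -[s1 v1] [/= s10 D1].
    rewrite lerBlDr -lerBlDl; apply: (le_q) => -[s2 v2] [/= s20 D2].
    rewrite lerBlDl.
    have [v [Dv thv ev]] := combine _ _ _ _ s10 D1 s20 D2.
    apply: le_trans (q_le _ (s1 + s2, v) _) _; first by split=> //=; exact: addr_ge0.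
    rewrite /f /= ev opprD addrACA.
    have := ler_wpM2l lam0 (ler_normD (u1 - s1 *: (v1 - xt)) (u2 - s2 *: (v2 - xt))).
    lra.
  move=> a u a0; rewrite -ler_pdivrMl //; apply: (le_q) => -[s v] [/= s0 Dv].
  rewrite ler_pdivrMl //; apply: le_trans (q_le _ (a * s, v) _) _.
    by split=> //=; rewrite mulr_ge0 // ltW.
  rewrite /f /= -scalerA -scalerBr normrZ (gtr0_norm a0); lra.
have [zeta [zq _]] := dual_hahn_banach 0 sq q_norm.
exists zeta; split=> v; first exact: le_trans (zq v) (q_norm v).
move=> Dv; have := le_trans (zq (v - xt)) (q_le _ (1, v) (conj ler01 Dv)).
by rewrite /f /= mul1r scale1r subrr normr0 mulr0 addr0; lra.
Qed.

(** Points of subdifferentiability approximate every point of the domain, in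
    value and with a favourable sign of the subgradient (a form of the
    Brondsted-Rockafellar theorem). *)
Lemma approx_subgradient (xd xt : X) (xi : dual X) (e : R) :
  D xd -> (forall v, D v -> th xd + (xi (v - xd) : R) <= th v) ->
  D xt -> 0 < e ->
  exists (w : X) (zeta : dual X), [/\ D w, `|w - xt| < e, th xt - e < th w,
    0 <= (zeta (xt - w) : R) &
    forall v, D v -> th w + (zeta (v - w) : R) <= th v].
Proof.
move=> Dxd xi_sub Dxt e0.
pose c := th xd - `|xi| * `|xt - xd|.
have minorant v : D v -> c - `|xi| * `|v - xt| <= th v.
  move=> Dv; have := xi_sub v Dv; have := ler_dual_norm xi (v - xd).
  rewrite ler_norml => /andP[h1 _].
  have := ler_wpM2l (normr_ge0 xi) (ler_distD xt v xd).
  by rewrite /c; lra.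
(* penalize with slope [n + |xi|], where the minorant bounds the functional *)
have wn (n : nat) : exists (w : X) (zeta : dual X), [/\ D w, n%:R * `|w - xt| <= th xt - c,
    th w <= th xt, 0 <= (zeta (xt - w) : R) &
    forall v, D v -> th w + (zeta (v - w) : R) <= th v].
  have lam0 : 0 <= n%:R + `|xi| by rewrite addr_ge0.
  have [v Dv|w Dw wmin] := @penalized_min xt (n%:R + `|xi|) c Dxt lam0.
    have := minorant v Dv; have := mulr_ge0 (ler0n R n) (normr_ge0 (v - xt)).
    by rewrite mulrDl; lra.
  have [zeta [znorm zsub]] := sandwich_norm Dxt lam0 wmin.
  exists w, zeta; have zxt := zsub w Dw; have zw := znorm (xt - w).
  have wxt := wmin xt Dxt; have wc := minorant w Dw.
  have wn0 := mulr_ge0 lam0 (normr_ge0 (w - xt)).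
  rewrite subrr normr0 mulr0 addr0 in wxt.
  rewrite distrC in zw; rewrite -opprB dualN in zw *.
  split=> //; first by move: wxt; rewrite mulrDl; lra.
  - by lra.
  - by lra.
  move=> v Dv; have := zsub v Dv.
  by have := dualD zeta (v - w) (w - xt); rewrite addrA subrK; lra.
have /choice[w /choice[zeta wP]] := wn.
have wxt : w @ \oo --> xt.
  apply/cvgrPdist_lt => d d0.
  have d1 : 0 < d / (th xt - c + 1).
    by have [_ + _ _ _] := wP 0%N; rewrite mul0r => ?; rewrite divr_gt0 //; lra.
  near=> n; have [_ wb _ _ _] := wP n.
  have n0 : 0 < n%:R :> R by rewrite ltr0n; near: n; exact: nbhs_infty_gt.
  rewrite distrC -(ltr_pM2l n0); apply: le_lt_trans wb _.
  have : (th xt - c + 1) / d < n%:R.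
    by near: n; exact: nbhs_infty_gtr.
  by rewrite ltr_pdivrMr //; lra.
have [n [wn1 wn2]] : exists n, `|w n - xt| < e /\ th xt - e < th (w n).
  apply: contrapT => /forallNP H.
  have [||_] := th_lsc (v := w) (w := xt) (m := th xt - e) _ wxt.
  - by move=> n; have [] := wP n.
  - move=> d d0; have /cvgrPdist_lt /(_ e e0) := wxt.
    apply: filterS => n; rewrite distrC => wn1; have := H n.
    by move=> /not_andP[//|/negP]; rewrite -leNgt; lra.
  by lra.
have [Dw _ _ z1 z2] := wP n.
by exists (w n), (zeta n).
Unshelve. all: by end_near. Qed.

End UniformlyConvex.

(** * Bregman distances of the restriction of a convex function *)

Lemma convex_set_comb {R : realType} {X : normedModType R} (A : set X)
    (x z : X) (t : R) :
  convex_set (A : set (convex_lmodType X)) -> 0 <= t <= 1 -> A x -> A z ->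
  A (t *: z + (1 - t) *: x).
Proof.
move=> cA /andP[t0 t1] /mem_set Ax /mem_set Az.
by have /set_mem := cA z x (Itv01 t0 t1) Az Ax.
Qed.

Section BregmanReal.
Context {R : realType} {X : completeNormedModType R}.
Implicit Types (Th : X -> \bar R) (x z : X) (xi : dual X) (DF : set X).

Lemma edom_fine Th x : eproper Th -> edom Th x -> Th x = (fine (Th x))%:E.
Proof.
by move=> [nTh _] xoo; rewrite fineK // fin_numE nTh lt_eqF.
Qed.

Lemma bregman_fine Th xi z x : eproper Th -> edom Th x -> edom Th z ->
  bregman Th xi z x = (fine (Th z) - fine (Th x) - (xi (z - x) : R))%:E.
Proof.
by move=> pTh dx dz; rewrite /bregman (edom_fine pTh dx) (edom_fine pTh dz).
Qed.

Lemma subdiff_fineP Th x xi : eproper Th -> edom Th x ->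
  subdiff Th x xi <->
  (forall z, edom Th z -> fine (Th x) + (xi (z - x) : R) <= fine (Th z)).
Proof.
move=> pTh dx; split=> [[_ xiP] z dz|xiP].
  by have := xiP z; rewrite bregman_fine // lee_fin; lra.
split=> // z; have [dz|] := boolP (Th z < +oo)%E.
  by rewrite bregman_fine // lee_fin; have := xiP z dz; lra.
rewrite -leNgt leye_eq /bregman => /eqP ->.
by rewrite (edom_fine pTh dx) !addye // leey.
Qed.

Lemma edom_restrict Th DF x : edom (restrict_ext Th DF) x <-> DF x /\ edom Th x.
Proof.
rewrite /edom /restrict_ext /=; case: ifPn => [/set_mem DFx|/negP xDF].
  by split=> [|[]].
by split=> [|[/mem_set]//]; rewrite ltxx.
Qed.

Lemma restrict_in Th DF x : DF x -> restrict_ext Th DF x = Th x.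
Proof. by move=> DFx; rewrite /restrict_ext mem_set. Qed.

Lemma eproper_restrict Th DF x : eproper Th -> DF x -> edom Th x ->
  eproper (restrict_ext Th DF).
Proof.
move=> [nTh _] DFx dx; split=> [z|]; last by exists x; rewrite restrict_in.
by rewrite /restrict_ext; case: ifP.
Qed.

Lemma p_convex_fine Th (p : R) : eproper Th -> p_convex Th p ->
  exists2 C0 : R, 0 < C0 & forall (x z : X) (lam : R), 0 < lam < 1 ->
    edom Th x -> edom Th z ->
    edom Th (lam *: z + (1 - lam) *: x) /\
    fine (Th (lam *: z + (1 - lam) *: x)) + C0 * lam * (1 - lam) * `|z - x| `^ p
      <= lam * fine (Th z) + (1 - lam) * fine (Th x).
Proof.
move=> pTh [C0 C00 cTh]; exists C0 => // x z lam lam01 dx dz.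
have := cTh x z lam lam01; rewrite [in leRHS](edom_fine pTh dx).
rewrite [in leRHS](edom_fine pTh dz) -!EFinM -EFinD => le1.
have dc : edom Th (lam *: z + (1 - lam) *: x).
  rewrite /edom /= ltNge leye_eq; apply/negP => /eqP Toc.
  by move: le1; rewrite Toc.
by split=> //; move: le1; rewrite (edom_fine pTh dc) -EFinD lee_fin.
Qed.

Lemma lower_semicontinuous_seq Th : eproper Th -> lower_semicontinuous Th ->
  forall (v : nat -> X) (w : X) (m : R), (forall n, edom Th (v n)) ->
  v @ \oo --> w ->
  (forall e : R, 0 < e -> \forall n \near \oo, fine (Th (v n)) <= m + e) ->
  edom Th w /\ fine (Th w) <= m.
Proof.
move=> pTh lTh v w m dv vw vm.
have Tw : (Th w <= m%:E)%E.
  rewrite leNgt; apply/negP => mTw.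
  have [a ma aTw] : exists2 a, m < a & (a%:E < Th w)%E.
    move: mTw; case E : (Th w) => [r| |//]; last first.
      by move=> _; exists (m + 1); [lra | rewrite ltry].
    by rewrite lte_fin => mr; exists ((m + r) / 2); rewrite ?lte_fin; lra.
  have [V Vw VP] := lTh w a aTw.
  have am0 : 0 < a - m by lra.
  have : \forall n \near \oo, False.
    near=> n; have vn : V (v n) by near: n; exact: vw.
    have := VP _ vn; rewrite (edom_fine pTh (dv n)) lte_fin.
    have : fine (Th (v n)) <= m + (a - m) by near: n; exact: vm.
    by rewrite addrC subrK leNgt => /negP.
  by case/filter_ex.
have dw : edom Th w by rewrite /edom /= (le_lt_trans Tw) // ltry.
by split=> //; move: Tw; rewrite {1}(edom_fine pTh dw) lee_fin.
Unshelve. all: by end_near. Qed.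

Lemma bregman_const_fine Th (p gam : R) : 0 < p -> 0 < gam -> eproper Th ->
  bregman_const Th p gam ->
  forall x z xi, edom Th x -> edom Th z -> subdiff Th x xi ->
  (`|z - x| / gam) `^ p <= fine (Th z) - fine (Th x) - (xi (z - x) : R).
Proof.
move=> p0 gam0 pTh bTh x z xi dx dz sxi.
have dsx : dom_subdiff Th x by split=> //; exists xi.
have := bTh x z xi dsx sxi; rewrite bregman_fine // poweR_EFin -EFinM lee_fin.
set d := _ - _ - _ => le_d.
have d0 : 0 <= d by have [_ /(_ z)] := sxi; rewrite bregman_fine // lee_fin.
rewrite -ler_pdivrMl // mulrC in le_d.
have dge : 0 <= `|z - x| / gam by rewrite divr_ge0 // ltW.
have := ge0_ler_powR (ltW p0) dge (powR_ge0 _ _) le_d.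
by rewrite -powRrM mulVf ?gt_eqF // powRr1.
Qed.

(** The Bregman inequality of [Th] extends, with the same constant, to
    subgradients of the restriction of [Th] to a convex set, although such
    subgradients need not come from subgradients of [Th] at the same point. *)
Lemma bregman_restrict_ge Th DF (p gam : R) (xd : X) :
  0 < p -> 0 < gam -> eproper Th -> lower_semicontinuous Th ->
  p_convex Th p -> bregman_const Th p gam -> dom_subdiff Th xd ->
  convex_set (DF : set (convex_lmodType X)) ->
  forall x z xi, edom (restrict_ext Th DF) x -> edom (restrict_ext Th DF) z ->
  subdiff (restrict_ext Th DF) x xi ->
  (`|z - x| / gam) `^ p <= fine (Th z) - fine (Th x) - (xi (z - x) : R).
Proof.
move=> p0 gam0 pTh lTh cTh bTh [dxd [xid sxid]] cDF x z xi.
move=> /edom_restrict[DFx dx] /edom_restrict[DFz dz] sxi.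
have [C0 C00 cvx] := p_convex_fine pTh cTh.
have lsc := lower_semicontinuous_seq pTh lTh.
have sxid' := (subdiff_fineP xid pTh dxd).1 sxid.
have pThF : eproper (restrict_ext Th DF) by exact: eproper_restrict dx.
set d := `|z - x|; set b := fine (Th z) - fine (Th x) - (xi (z - x) : R).
(* convexity along the segment, tested at a nearby point of subdifferentiability *)
have key (t r : R) : 0 < t < 1 -> 0 <= r < (1 - t) * d -> (r / gam) `^ p <= b.
  move=> t01 /andP[r0 rd]; have /andP[t0 t1] := t01.
  pose xt := t *: z + (1 - t) *: x.
  have DFt : DF xt by apply: convex_set_comb => //; rewrite !ltW.
  have [dt _] := cvx x z t t01 dx dz; rewrite -/xt in dt.
  have xiP : fine (Th x) + t * (xi (z - x) : R) <= fine (Th xt).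
    have dxF : edom (restrict_ext Th DF) x by exact/edom_restrict.
    have dtF : edom (restrict_ext Th DF) xt by exact/edom_restrict.
    have := (subdiff_fineP xi pThF dxF).1 sxi xt dtF.
    rewrite !restrict_in // -dualZ /xt scalerBl scale1r scalerBr.
    by rewrite addrCA addrA (addrC x) addrAC addrK addrC.
  have zxt : `|z - xt| = (1 - t) * d.
    have -> : z - xt = (1 - t) *: (z - x).
      by rewrite /xt scalerBr opprD addrA [(1 - t) *: z]scalerBl scale1r.
    by rewrite normrZ gtr0_norm // subr_gt0.
  apply/ler_addgt0Pr => e e0.
  pose e' := Num.min (t * e) ((1 - t) * d - r).
  have e'0 : 0 < e' by rewrite lt_min mulr_gt0 //= subr_gt0.
  have [w [zeta [dw we thw zxw zsub]]] :=
    approx_subgradient p0 C00 cvx lsc dxd sxid' dt e'0.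
  have sz : subdiff Th w zeta by exact/(subdiff_fineP zeta pTh dw).
  have bz := bregman_const_fine p0 gam0 pTh bTh dw dz sz.
  have bx := zsub x dx.
  have e't : e' <= t * e by rewrite ge_min lexx.
  have e'd : e' <= (1 - t) * d - r by rewrite ge_min lexx orbT.
  have rz : r <= `|z - w|.
    by have := ler_distD w z xt; rewrite zxt; lra.
  have : (r / gam) `^ p <= (`|z - w| / gam) `^ p.
    apply: ge0_ler_powR; rewrite ?nnegrE ?(ltW p0) ?divr_ge0 ?(ltW gam0) //.
    by rewrite ler_pM2r ?invr_gt0.
  move=> /le_trans/(_ bz) bz'.
  have zxtE : (zeta (xt - w) : R) =
      t * (zeta (z - w) : R) + (1 - t) * (zeta (x - w) : R).
    by rewrite !dualB /xt dualD !dualZ; ring.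
  rewrite -(ler_pM2l t0); apply: le_trans (ler_wpM2l (ltW t0) bz') _.
  have := ler_wpM2l (ltW (_ : 0 < 1 - t)) bx; rewrite subr_gt0 => /(_ t1).
  by move: zxw; rewrite zxtE /b; lra.
have b0 : 0 <= b.
  have [_ /(_ z)] := sxi; rewrite bregman_fine //; last 2 first.
  - exact/edom_restrict.
  - exact/edom_restrict.
  by rewrite lee_fin !restrict_in.
have dge : 0 <= d by exact: normr_ge0.
rewrite leNgt; apply/negP => bd.
have d0 : 0 < d.
  rewrite lt0r dge andbT; apply/eqP => dd.
  by move: bd; rewrite dd mul0r powR0 ?gt_eqF // ltNge b0.
(* the radius at which the Bregman inequality would just hold *)
pose r0 := gam * b `^ p^-1.
have bK : (b `^ p^-1) `^ p = b by rewrite -powRrM mulVf ?gt_eqF // powRr1.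
have r0d : r0 < d.
  rewrite ltNge; apply/negP => ler.
  have : (d / gam) `^ p <= b.
    rewrite -[leRHS]bK.
    apply: ge0_ler_powR; rewrite ?nnegrE ?(ltW p0) ?powR_ge0 ?divr_ge0 ?(ltW gam0) //.
    by rewrite ler_pdivrMr // mulrC.
  by rewrite leNgt bd.
have r00 : 0 <= r0 by rewrite mulr_ge0 ?powR_ge0 // ltW.
pose r := (r0 + d) / 2.
have rr : r0 < r < d by rewrite /r; apply/andP; split; lra.
case/andP: rr => r0r rd.
pose t := (1 - r / d) / 2.
have t01 : 0 < t < 1.
  have h1 : r / d < 1 by rewrite ltr_pdivrMr // mul1r.
  have h2 : 0 <= r / d by rewrite divr_ge0 // ltW // (le_lt_trans r00).
  by rewrite /t; apply/andP; split; lra.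
have rlt : 0 <= r < (1 - t) * d.
  rewrite (ltW (le_lt_trans r00 r0r)) /=.
  have -> : (1 - t) * d = (d + r) / 2 by rewrite /t; field; rewrite gt_eqF.
  by lra.
have := key t r t01 rlt; rewrite leNgt => /negP; apply.
rewrite -[ltLHS]bK.
have rge : 0 <= r / gam by rewrite divr_ge0 ?(ltW gam0) // (le_trans r00) ?ltW.
apply: gt0_ltr_powR; rewrite ?nnegrE ?powR_ge0 //.
by rewrite ltr_pdivlMr // mulrC.
Qed.

End BregmanReal.

(** * Linearisation error of the forward operator *)

Section Linearization.
Context {R : realType}.

Lemma bounded_opB {X Y : normedModType R} (f g : bounded_op X Y) (w : X) :
  (f - g) w = f w - g w.
Proof. by []. Qed.

Lemma bounded_opZ {X Y : normedModType R} (f : bounded_op X Y) (a : R) (w : X) :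
  f (a *: w) = a *: f w.
Proof. exact: linearZ. Qed.

Lemma telescope_sub (V : zmodType) (a b c d e : V) :
  a - (c + d) - (b - c) = (a - b - e) + (e - d).
Proof.
rewrite [RHS]addrA subrK opprB opprD -addrA addrACA addNr add0r addrA.
by rewrite addrAC.
Qed.

Lemma near_0_right (P : R -> Prop) : (\forall s \near 0^'+, P s) ->
  exists2 eta, 0 < eta & forall s, 0 < s < eta -> P s.
Proof.
rewrite /at_right near_withinE => /nbhs_ballP[eta /= eta0 etaP].
exists eta => // s /andP[s0 seta]; apply: etaP => //.
by rewrite -ball_normE /= sub0r normrN gtr0_norm.
Qed.

(** A mean value inequality for vector functions under one-sided bounds on
    difference quotients. *)
Lemma mean_value_le (Y : normedModType R) (psi : R -> Y) (M : R) : 0 <= M ->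
  (forall t : R, 0 <= t < 1 -> forall e : R, 0 < e -> exists2 eta : R, 0 < eta &
    forall s, 0 < s < eta -> `|psi (t + s) - psi t| <= (M + e) * s) ->
  (forall t : R, 0 < t <= 1 -> exists c eta : R, [/\ 0 <= c, 0 < eta &
    forall s, 0 < s < eta -> `|psi (t - s) - psi t| <= c * s]) ->
  `|psi 1 - psi 0| <= M.
Proof.
move=> M0 rightM leftc; apply/ler_addgt0Pr => e e0.
have Me0 : 0 < M + e by lra.
(* the supremum of [S] belongs to [S] by the left bound, and is 1 by the right
   bound *)
pose S := [set t : R | 0 <= t <= 1 /\ `|psi t - psi 0| <= (M + e) * t].
have S0 : S 0 by split; [rewrite lexx ler01|rewrite subrr normr0 mulr0].
have Sub : has_ubound S by exists 1 => t [/andP[]].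
pose m := sup S.
have m0 : 0 <= m by apply: ub_le_sup Sub _ S0.
have m1 : m <= 1 by apply: ge_sup; [exists 0|move=> t [/andP[]]].
have Sm : S m.
  split; first by rewrite m0 m1.
  have [m_eq0|mgt0] := eqVneq m 0; first by rewrite m_eq0 subrr normr0 mulr0.
  have mpos : 0 < m by rewrite lt0r mgt0.
  have [|c [eta [c0 eta0 cP]]] := leftc m; first by rewrite mpos m1.
  apply/ler_addgt0Pr => d d0.
  pose d' := Num.min eta (d / (c + 1)).
  have c1 : 0 < c + 1 by lra.
  have d'0 : 0 < d' by rewrite lt_min eta0 divr_gt0.
  have [t St mt] := sup_adherent d'0 (conj (ex_intro _ 0 S0) Sub).
  have tm : t <= m by apply: ub_le_sup Sub _ St.
  case: St => _ tle.
  have [tm0|tm0] := eqVneq t m.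
    by rewrite -tm0 (le_trans tle) // lerDl ltW.
  have s0 : 0 < m - t by rewrite subr_gt0 lt_neqAle tm0.
  have sd : m - t < d'.
    by move: mt; rewrite -/m ltrBlDr ltrBlDl.
  have := cP (m - t); rewrite s0 (lt_le_trans sd) ?ge_min ?lexx // subKr.
  move=> /(_ isT) ct.
  have : c * (m - t) <= d.
    have : m - t <= d / (c + 1).
      by rewrite (le_trans (ltW sd)) // ge_min lexx orbT.
    by rewrite ler_pdivlMr //; lra.
  have := ler_distD (psi t) (psi m) (psi 0); rewrite (distrC (psi m) (psi t)).
  have := ler_wpM2l (ltW Me0) tm; lra.
case: (Sm) => _ mle.
have [m_eq1|m_neq1] := eqVneq m 1; first by move: mle; rewrite m_eq1 mulr1.
have mlt1 : m < 1 by rewrite lt_neqAle m_neq1.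
have [|eta eta0 etaP] := rightM m _ e e0; first by rewrite m0.
pose s := Num.min (eta / 2) (1 - m).
have s0 : 0 < s by rewrite lt_min divr_gt0 //= subr_gt0.
have seta : s < eta by rewrite (@le_lt_trans _ _ (eta / 2)) ?ge_min ?lexx //; lra.
have s1 : s <= 1 - m by rewrite ge_min lexx orbT.
have : S (m + s).
  split; first by apply/andP; split; lra.
  have := etaP s; rewrite s0 seta => /(_ isT).
  have := ler_distD (psi m) (psi (m + s)) (psi 0); lra.
by move=> /(ub_le_sup Sub); rewrite -/m; lra.
Qed.

(** Mean value inequality along the segment from [xd] to [x]; the direction
    limits of [F] towards [x] and towards [xd] provide the two one-sided bounds. *)
Lemma linearization_error (X Y : normedModType R) (DF : set X) (F : X -> Y)
    (dF : X -> bounded_op X Y) (xd : X) (rho K0 K1 : R) :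
  convex_set (DF : set (convex_lmodType X)) -> DF xd -> 0 < rho ->
  dir_derivable DF F dF xd rho -> 0 <= K0 -> 0 <= K1 ->
  nonlinearity_cond DF dF xd rho K0 K1 ->
  forall x, (ball xd rho `&` DF) x ->
  `|F x - F xd - dF xd (x - xd)| <=
    (K0 + K1) * `|x - xd| * `|dF xd (x - xd)|.
Proof.
move=> cDF DFxd rho0 derF K00 K10 nlF x [bx DFx].
set h := x - xd; set M := (K0 + K1) * _ * _.
pose xt (t : R) : X := xd + t *: h.
have M0 : 0 <= M by rewrite !mulr_ge0 ?addr_ge0.
have x0 : xt 0 = xd by rewrite /xt scale0r addr0.
have x1 : xt 1 = x by rewrite /xt scale1r /h addrC subrK.
have hrho : `|h| < rho by move: bx; rewrite -ball_normE /= distrC.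
have Bt t : 0 <= t <= 1 -> (ball xd rho `&` DF) (xt t).
  move=> t01; have /andP[t0 t1] := t01; split.
    rewrite -ball_normE /= /xt opprD addrA subrr sub0r normrN normrZ ger0_norm //.
    by apply: le_lt_trans hrho; rewrite ler_piMl.
  have -> : xt t = t *: x + (1 - t) *: xd.
    by rewrite /xt /h scalerBr scalerBl scale1r addrCA.
  exact: convex_set_comb.
have Bxd : (ball xd rho `&` DF) xd by split=> //; exact: ballxx.
have dM t : 0 <= t <= 1 -> `|dF (xt t) h - dF xd h| <= M.
  move=> t01; have /andP[t0 t1] := t01; rewrite -bounded_opB.
  apply: le_trans (nlF h xd (xt t) Bxd (Bt t t01)) _.
  have -> : xt t - xd = t *: h by rewrite /xt addrAC subrr add0r.
  rewrite bounded_opZ !normrZ (ger0_norm t0) /M.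
  have a0 := mulr_ge0 (mulr_ge0 K00 (normr_ge0 h)) (normr_ge0 (dF xd h)).
  have b0 := mulr_ge0 (mulr_ge0 K10 (normr_ge0 h)) (normr_ge0 (dF xd h)).
  have := ler_wpM2l a0 t1; have := ler_wpM2l b0 t1; lra.
pose psi t := F (xt t) - t *: dF xd h.
have -> : F x - F xd - dF xd h = psi 1 - psi 0.
  by rewrite /psi x0 x1 scale1r scale0r subr0 addrAC.
(* quotient of [F] from [xt t] towards [z], along the segment *)
have quot t z (e : R) : 0 <= t <= 1 -> (ball xd rho `&` DF) z -> 0 < e ->
    exists2 eta : R, 0 < eta & forall s, 0 < s < eta ->
    `|F (xt t + s *: (z - xt t)) - F (xt t) - s *: dF (xt t) (z - xt t)| <= e * s.
  move=> t01 Bz e0.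
  have /cvgrPdist_lt /(_ e e0) /near_0_right [eta eta0 etaP] :=
    derF _ _ (Bt t t01) Bz.
  exists eta => // s s0eta; have /andP[s0 _] := s0eta.
  have := etaP s s0eta; rewrite distrC => /ltW.
  rewrite -(ler_pM2l s0) -[X in X * _ <= _](gtr0_norm s0) -normrZ.
  by rewrite scalerBr scalerA mulfV ?gt_eqF // scale1r (mulrC s).
apply: mean_value_le => // t.
  move=> /andP[t0 t1] e e0; have t1' : 0 < 1 - t by rewrite subr_gt0.
  have [||eta eta0 etaP] := quot t x (e * (1 - t)) _ _ (mulr_gt0 e0 t1').
  - by rewrite t0 ltW.
  - by [].
  exists (eta * (1 - t)); first by rewrite mulr_gt0.
  move=> s /andP[s0 seta].
  have := etaP (s / (1 - t)); rewrite divr_gt0 // ltr_pdivrMr // seta.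
  have -> : x - xt t = (1 - t) *: h.
    by rewrite -x1 /xt opprD addrACA subrr add0r -scalerBl.
  rewrite bounded_opZ !scalerA divfK ?gt_eqF //.
  have -> : xt t + s *: h = xt (t + s) by rewrite /xt scalerDl addrA.
  move=> /(_ isT) le1.
  have -> : psi (t + s) - psi t =
      (F (xt (t + s)) - F (xt t) - s *: dF (xt t) h) +
      s *: (dF (xt t) h - dF xd h).
    by rewrite /psi scalerBr scalerDl; exact: telescope_sub.
  apply: le_trans (ler_normD _ _) _; rewrite addrC mulrDl lerD //.
    rewrite normrZ gtr0_norm // mulrC ler_wpM2r ?(ltW s0) //.
    by apply: dM; rewrite t0 ltW.
  by apply: le_trans le1 _; rewrite -mulrA [_ * (s / _)]mulrC divfK // gt_eqF.
move=> /andP[t0 t1].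
have [|eta eta0 etaP] := quot t xd 1 _ Bxd ltr01; first by rewrite ltW.
pose c := t^-1 + `|dF (xt t) h| + `|dF xd h|.
have ti0 : 0 < t^-1 by rewrite invr_gt0.
exists c, (eta * t); split.
- by rewrite !addr_ge0 // ltW.
- by rewrite mulr_gt0.
move=> s /andP[s0 seta].
have := etaP (s / t); rewrite divr_gt0 // ltr_pdivrMr // seta.
have -> : xd - xt t = - t *: h by rewrite /xt opprD addrA subrr sub0r scaleNr.
rewrite bounded_opZ !scalerA mulrN divfK ?gt_eqF // mul1r !scaleNr.
have -> : xt t - s *: h = xt (t - s) by rewrite /xt scalerBl addrA.
move=> /(_ isT) le1.
have -> : psi (t - s) - psi t =
    (F (xt (t - s)) - F (xt t) - - (s *: dF (xt t) h)) +
    (- (s *: dF (xt t) h) - - (s *: dF xd h)).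
  by rewrite /psi scalerBl; exact: telescope_sub.
apply: le_trans (ler_normD _ _) _; apply: le_trans (lerD le1 (ler_normB _ _)) _.
by rewrite !normrN !normrZ (gtr0_norm s0) /c; lra.
Qed.

End Linearization.

(** * Power inequalities *)

Section PowerInequalities.
Context {R : realType}.
Implicit Types x y p : R.

Lemma powR_superadditive p x y : 1 <= p -> 0 <= x -> 0 <= y ->
  x `^ p + y `^ p <= (x + y) `^ p.
Proof.
move=> p1 x0 y0; have p0 : 0 < p by lra.
have xy0 : 0 <= x + y by rewrite addr_ge0.
have p10 : 0 <= p - 1 by lra.
rewrite -(mulr_powRB1 x0 p0) -(mulr_powRB1 y0 p0) -(mulr_powRB1 xy0 p0) mulrDl lerD // ler_wpM2l //.
  by apply: ge0_ler_powR; rewrite ?nnegrE // lerDl.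
by apply: ge0_ler_powR; rewrite ?nnegrE // lerDr.
Qed.

(** Turns the minimality inequality of one step into an error bound. *)
Lemma powR_absorb p (d s eta : R) : 2 <= p -> 0 <= d -> 0 <= s -> 0 <= eta ->
  d `^ p <= s `^ p + eta `^ (p - 1) * d -> d <= s + eta.
Proof.
move=> p2 d0 s0 eta0 led; rewrite leNgt; apply/negP => lt_d.
have p0 : 0 < p by lra.
have p10 : 0 < p - 1 by lra.
have se0 : 0 <= s + eta by rewrite addr_ge0.
have dpos : 0 < d by apply: le_lt_trans se0 lt_d.
have p1 : 1 <= p - 1 by lra.
have := powR_superadditive p1 s0 eta0.
have : (s + eta) `^ (p - 1) < d `^ (p - 1).
  by apply: gt0_ltr_powR; rewrite ?nnegrE.
have : s * s `^ (p - 1) <= d * s `^ (p - 1).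
  by rewrite ler_wpM2r ?powR_ge0 //; lra.
move: led; rewrite -(mulr_powRB1 d0 p0) -(mulr_powRB1 s0 p0).
move=> h1 h2 h3 h4.
have := ltr_pM2l dpos (s `^ (p - 1) + eta `^ (p - 1)) (d `^ (p - 1)).
rewrite (le_lt_trans h4 h3) mulrDr; lra.
Qed.

(** Turns the minimality inequality of one step into a residual bound. *)
Lemma powR_residual p (r s a d eta : R) : 2 <= p -> 0 <= r -> 0 <= s ->
  0 <= a -> 0 <= d -> 0 <= eta ->
  r `^ p + a `^ p * d `^ p <= s `^ p + a `^ p * (eta `^ (p - 1) * d) ->
  r <= s + a * eta.
Proof.
move=> p2 r0 s0 a0 d0 eta0 ler.
have p0 : 0 < p by lra.
have p10 : 0 <= p - 1 by lra.
have key : eta `^ (p - 1) * d - d `^ p <= eta `^ p.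
  rewrite -(mulr_powRB1 d0 p0) -(mulr_powRB1 eta0 p0).
  have [de|ed] := leP d eta.
    have := ler_wpM2r (powR_ge0 eta (p - 1)) de.
    by have := mulr_ge0 d0 (powR_ge0 d (p - 1)); lra.
  have : eta `^ (p - 1) <= d `^ (p - 1).
    by apply: ge0_ler_powR; rewrite ?nnegrE // ltW.
  move/(ler_wpM2l d0); have := mulr_ge0 eta0 (powR_ge0 eta (p - 1)); lra.
have le1 : r `^ p <= (s + a * eta) `^ p.
  have p1 : 1 <= p by lra.
  apply: le_trans (powR_superadditive p1 s0 (mulr_ge0 a0 eta0)).
  rewrite powRM //; have := ler_wpM2l (powR_ge0 a p) key; lra.
have sa0 : 0 <= s + a * eta by rewrite addr_ge0 ?mulr_ge0.
rewrite leNgt; apply/negP => lt1; move: le1; rewrite leNgt => /negP; apply.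
by apply: gt0_ltr_powR; rewrite ?nnegrE.
Qed.

End PowerInequalities.

(** * One step of the method *)

(** Here [eta] is [(gam * |xi0 - xid|) ^ (1/(p-1))]. *)
Section Step.
Context {R : realType} {X Y : completeNormedModType R}.
Variables (Th : X -> \bar R) (DF : set X) (F : X -> Y)
  (dF : X -> bounded_op X Y) (p gam eta : R) (xd x0 : X) (xi0 xid : dual X).
Hypotheses (p_ge2 : 2 <= p) (gam_gt0 : 0 < gam) (eta_ge0 : 0 <= eta).
Hypothesis etaE : eta `^ (p - 1) = gam * `|xi0 - xid|.
Hypothesis pTh : eproper Th.
Hypotheses (dom_xd : edom (restrict_ext Th DF) xd)
  (dom_x0 : edom (restrict_ext Th DF) x0).
Hypothesis bregman_xd : forall z, edom (restrict_ext Th DF) z ->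
  (`|z - xd| / gam) `^ p <=
    fine (Th z) - fine (Th xd) - (xid (z - xd) : R).

Let p_gt0 : 0 < p. Proof. exact: lt_le_trans p_ge2. Qed.

Lemma dual_diff_le (z : X) :
  (xi0 (z - xd) : R) - (xid (z - xd) : R) <=
    eta `^ (p - 1) * (`|z - xd| / gam).
Proof.
have -> : eta `^ (p - 1) * (`|z - xd| / gam) = `|xi0 - xid| * `|z - xd|.
  by rewrite etaE; field; rewrite gt_eqF.
apply: le_trans (ler_norm _) _.
exact: (ler_dual_norm (xi0 - xid) (z - xd)).
Qed.

Lemma initial_dist :
  unique_minimizer (fun x => restrict_ext Th DF x - (xi0 x : R)%:E)%E x0 ->
  `|x0 - xd| <= gam * eta.
Proof.
move=> [minx0 _].
have [DFd dd] := (edom_restrict Th DF xd).1 dom_xd.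
have [DF0 d0] := (edom_restrict Th DF x0).1 dom_x0.
have := minx0 xd; rewrite !restrict_in // (edom_fine pTh dd).
rewrite (edom_fine pTh d0) lee_fin => le0.
have := bregman_xd dom_x0; have := dual_diff_le x0; rewrite (dualB xi0).
move=> h1 h2.
have dge : 0 <= `|x0 - xd| / gam by rewrite divr_ge0 // ltW.
rewrite -ler_pdivrMl // mulrC -[leRHS]add0r.
apply: (powR_absorb p_ge2) => //; rewrite powR0 ?gt_eqF // add0r.
lra.
Qed.

(** The minimiser [x] is compared with [xd]; the change of base point from
    [(x0, xi0)] to [(xd, xid)] in the Bregman distance costs the linear term. *)
Lemma LM_minimality (a : R) (yd : Y) (xn x : X) : 0 < a ->
  unique_minimizer (LM_functional Th DF F dF p a xi0 x0 yd xn) x ->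
  edom (restrict_ext Th DF) x /\
  `|yd - F xn - dF xn (x - xn)| `^ p + a * (`|x - xd| / gam) `^ p <=
    `|yd - F xn - dF xn (xd - xn)| `^ p +
    a * (eta `^ (p - 1) * (`|x - xd| / gam)).
Proof.
move=> a0 [/(_ xd) + _].
have [DFd dd] := (edom_restrict Th DF xd).1 dom_xd.
have [DF0 d0] := (edom_restrict Th DF x0).1 dom_x0.
have pThF : eproper (restrict_ext Th DF) by exact: eproper_restrict d0.
rewrite /LM_functional (bregman_fine xi0 pThF dom_x0 dom_xd).
rewrite -EFinM -EFinD => le1.
have dx : edom (restrict_ext Th DF) x.
  apply: contrapT => /negP; rewrite -leNgt leye_eq => /eqP Tx.
  move: le1; rewrite /bregman Tx (edom_fine pThF dom_x0) !addye //.
  by rewrite gt0_muley ?lte_fin // addey.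
split=> //; have [DFx dx'] := (edom_restrict Th DF x).1 dx.
move: le1; rewrite (bregman_fine xi0 pThF dom_x0 dx) -EFinM -EFinD lee_fin.
rewrite !restrict_in //.
have := bregman_xd dx; have := dual_diff_le x; rewrite !dualB.
set v := _ `^ p; set D := _ * (_ / gam); set b1 := `|_| `^ p; set b2 := `|_| `^ p.
move=> h1 h2 h3.
have := ler_wpM2l (ltW a0) (lerD h1 h2); lra.
Qed.

Lemma LM_step (a : R) (yd : Y) (xn x : X) : 0 < a ->
  unique_minimizer (LM_functional Th DF F dF p (a `^ p) xi0 x0 yd xn) x ->
  [/\ DF x,
    `|x - xd| <= gam * (`|yd - F xn - dF xn (xd - xn)| / a + eta) &
    `|yd - F xn - dF xn (x - xn)| <=
      `|yd - F xn - dF xn (xd - xn)| + a * eta].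
Proof.
move=> a0 minx; have ap0 : 0 < a `^ p by rewrite powR_gt0.
have [/edom_restrict[DFx _] le1] := LM_minimality ap0 minx.
have dge : 0 <= `|x - xd| / gam by rewrite divr_ge0 // ltW.
split=> //; last exact: (powR_residual p_ge2 _ _ (ltW a0) dge eta_ge0 le1).
rewrite -ler_pdivrMl // mulrC; apply: (powR_absorb p_ge2 dge) => //.
  by rewrite divr_ge0 // ltW.
have apn : a `^ p != 0 by rewrite gt_eqF.
have -> : (`|yd - F xn - dF xn (xd - xn)| / a) `^ p =
    `|yd - F xn - dF xn (xd - xn)| `^ p / a `^ p.
  rewrite -[in RHS](@divfK _ a _ `|yd - _ - _|) ?gt_eqF //.
  by rewrite [in RHS]powRM ?mulfK ?divr_ge0 // ltW.
rewrite -(ler_pM2l ap0) mulrDr [a `^ p * (_ / _)]mulrCA mulfV // mulr1.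
by apply: le_trans le1; rewrite lerDr powR_ge0.
Qed.

End Step.

(** * The iteration up to the stopping index *)

Lemma residual_split (V : zmodType) (v f y w k : V) :
  v - f + k = (v - y) - (f - y - w) + (k - w).
Proof. by rewrite !opprB [w + _]addrC [k - w]addrC !addrA subrK addrK. Qed.

Lemma residual_telescope (V : zmodType) (v f f' y w w' m : V) :
  f' - v = ((f' - y - w') - (f - y - w)) - (m - (w' - w)) - (v - f - m).
Proof.
have -> : f' - y - w' - (f - y - w) = f' - f - (w' - w).
  rewrite [- (f - y - w)]opprB [w - (f - y)]addrC addrACA [- (f - y)]opprB.
  by rewrite subrKA [- w' + w]addrC [- (w' - w)]opprB.
by rewrite [- (m - _)]opprB subrKA [- (v - f - m)]opprB subrKA opprB subrKA.
Qed.

Section Iteration.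
Context {R : realType} {X Y : completeNormedModType R}.
Variables (Th : X -> \bar R) (DF : set X) (F : X -> Y)
  (dF : X -> bounded_op X Y) (p gam mu tau rho K0 K1 : R) (alpha : nat -> R)
  (xd x0 : X) (xi0 xid : dual X).
(** [E] stands for [|xi0 - xid| ^ (1/(p-1))], [g] for [gam ^ (1/(p-1))], [q]
    for [theta ^ (1/p)] and [a n] for [alpha n ^ (1/p)]; the error and the image
    error of the iterates will be at most [C * E] and [B * E * a n], and [kap]
    is the small parameter. *)
Variables (E g q B C kap : R) (a : nat -> R).

Hypotheses (p_ge2 : 2 <= p) (gam_gt0 : 0 < gam) (mu_gt0 : 0 < mu)
  (tau_gt1 : 1 < tau) (E_ge0 : 0 <= E) (g_gt0 : 0 < g) (q_ge1 : 1 <= q)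
  (K0_ge0 : 0 <= K0) (K1_ge0 : 0 <= K1).
Hypothesis etaE : (g * E) `^ (p - 1) = gam * `|xi0 - xid|.
Hypotheses (a_gt0 : forall n, 0 < a n) (aE : forall n, a n `^ p = alpha n)
  (a_decr : forall n, a n.+1 <= a n) (a_slow : forall n, a n <= q * a n.+1).
Hypotheses (CE : gam * (mu + 2 * g) <= C) (CE_rho : C * E < rho)
  (BE : B = 4 * (2 * mu + g) * q) (kapE : (K0 + K1) * (C * E) <= kap).
Hypotheses (kap_half : kap <= 2^-1) (kap_B : 5 * (kap * B) <= 2 * mu + g)
  (kap_g : 2 * (kap * B) <= g)
  (kap_tau : (g + 8 * (kap * B)) * q ^+ 2 <= mu * (tau - 1)).
Hypothesis pTh : eproper Th.
Hypotheses (dom_xd : edom (restrict_ext Th DF) xd)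
  (dom_x0 : edom (restrict_ext Th DF) x0).
Hypothesis bregman_xd : forall z, edom (restrict_ext Th DF) z ->
  (`|z - xd| / gam) `^ p <=
    fine (Th z) - fine (Th xd) - (xid (z - xd) : R).
Hypothesis min_x0 :
  unique_minimizer (fun x => restrict_ext Th DF x - (xi0 x : R)%:E)%E x0.
Hypothesis norm_T : `|dF xd| <= a 0%N / gam.
Hypothesis nlF : nonlinearity_cond DF dF xd rho K0 K1.
Hypothesis linF : forall x, (ball xd rho `&` DF) x ->
  `|F x - F xd - dF xd (x - xd)| <=
    (K0 + K1) * `|x - xd| * `|dF xd (x - xd)|.

Variables (yd : Y) (delta : R) (u : nat -> X).
Hypotheses (delta_gt0 : 0 < delta) (yd_delta : `|yd - F xd| <= delta).
Hypothesis u_LM : LM_iteration Th DF F dF p alpha xd rho xi0 x0 yd u.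

Let d n := `|u n - xd|.
Let t n := `|dF xd (u n - xd)|.
Let res n := `|F (u n) - yd|.
Let kb := kap * B.

Let C_gt0 : 0 < C.
Proof. by apply: lt_le_trans CE; rewrite mulr_gt0 // addr_gt0 // mulr_gt0. Qed.

Let kap_ge0 : 0 <= kap.
Proof.
by apply: le_trans kapE; rewrite mulr_ge0 ?addr_ge0 // mulr_ge0 // ltW.
Qed.

Let B_gt0 : 0 < B.
Proof.
rewrite BE mulr_gt0 ?mulr_gt0 ?addr_gt0 ?mulr_gt0 //.
exact: lt_le_trans q_ge1.
Qed.

Let kb_ge0 : 0 <= kb. Proof. by rewrite mulr_ge0 // ltW. Qed.

(** The iterate lies in the region where the method is meaningful and its
    errors are under control. *)
Definition controlled n :=
  [/\ DF (u n), d n <= C * E & t n <= B * (E * a n)].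

Let controlled_ball n : controlled n -> (ball xd rho `&` DF) (u n).
Proof.
move=> [DFn dn _]; split=> //; rewrite -ball_normE /= distrC.
exact: le_lt_trans dn CE_rho.
Qed.

Let kap_d (z : R) : z <= C * E -> (K0 + K1) * z <= kap.
Proof. by move=> zC; apply: le_trans kapE; rewrite ler_wpM2l ?addr_ge0. Qed.

Let T_err n (w : X) : (ball xd rho `&` DF) (u n) ->
  `|dF (u n) w - dF xd w| <= K0 * d n * `|dF xd w| + K1 * t n * `|w|.
Proof.
move=> Bn; rewrite -bounded_opB; apply: nlF => //; split.
  by apply: ballxx; apply: le_lt_trans CE_rho; rewrite mulr_ge0 // ltW.
by have /edom_restrict[] := dom_xd.
Qed.

Lemma controlled0 : controlled 0 /\ t 0 <= g * (E * a 0).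
Proof.
have mu0 := mu_gt0; have g0 := g_gt0; have q1 := q_ge1.
have gE0 : 0 <= g * E by rewrite mulr_ge0 // ltW.
have d0 : d 0 <= gam * (g * E).
  have [u0 _] := u_LM; rewrite /d u0.
  exact: (initial_dist p_ge2 gam_gt0 gE0 etaE pTh dom_xd dom_x0 bregman_xd).
have Ea0 : 0 <= E * a 0 by rewrite mulr_ge0 // ltW.
have t0 : t 0 <= g * (E * a 0).
  apply: le_trans (ler_op_norm _ _) _.
  apply: le_trans (ler_pM (normr_ge0 _) (normr_ge0 _) norm_T d0) _.
  rewrite [leLHS](_ : _ = g * (E * a 0)) //.
  by field; rewrite gt_eqF.
split=> //; split.
- by have [-> _] := u_LM; have /edom_restrict[] := dom_x0.
- apply: le_trans d0 _; rewrite mulrA ler_wpM2r //; apply: le_trans CE.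
  by rewrite ler_wpM2l ?(ltW gam_gt0) //; lra.
- apply: le_trans t0 _; rewrite ler_wpM2r // BE.
  have : 0 <= (q - 1) * (2 * mu + g) by rewrite mulr_ge0 ?subr_ge0 //; lra.
  lra.
Qed.

Lemma res0_le : res 0 <= delta + (g + kb) * (E * a 0).
Proof.
have [c0 t0] := controlled0; have [_ dn tn] := c0.
have lin := linF (controlled_ball c0).
have Kd := kap_d dn.
have := ler_wpM2r (normr_ge0 (dF xd (u 0 - xd))) Kd; rewrite -/(t 0) -/(d 0) => Kt.
have kt := ler_wpM2l kap_ge0 tn; rewrite [leRHS]mulrA -/kb in kt.
rewrite -/(d 0) -/(t 0) in lin.
have -> : res 0 = `|(F (u 0) - F xd - dF xd (u 0 - xd)) +
    dF xd (u 0 - xd) - (yd - F xd)|.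
  by rewrite subrK opprB addrA subrK.
apply: le_trans (ler_normB _ _) _; apply: le_trans (lerD (ler_normD _ _) yd_delta) _.
rewrite -/(t 0); lra.
Qed.

(** As long as the noise level is below [mu * E * a n], control propagates from
    one iterate to the next. *)
Lemma controlled_step n : controlled n -> delta <= mu * (E * a n) ->
  controlled n.+1 /\ res n.+1 <= delta + (g + 8 * kb) * (E * a n).
Proof.
have mu0 := mu_gt0; have g0 := g_gt0; have E0 := E_ge0.
have hy := yd_delta; have kh := kap_half; have kB := kap_B; have kg := kap_g; have k0 := kap_ge0.
move=> cn dmu; have [DFn dn tn] := cn; have Bn := controlled_ball cn.
have [_ /(_ n Bn)] := u_LM; rewrite -aE => minS.
have gE0 : 0 <= g * E by rewrite mulr_ge0 // ltW.
have [DFS dS rS] :=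
  LM_step p_ge2 gam_gt0 gE0 etaE pTh dom_xd dom_x0 bregman_xd (a_gt0 n) minS.
set s := `|yd - F (u n) - dF (u n) (xd - u n)| in dS rS.
set r := `|yd - F (u n) - dF (u n) (u n.+1 - u n)| in rS.
rewrite -/(d n.+1) in dS.
set w := E * a n in tn dmu *.
have w0 : 0 <= w by rewrite mulr_ge0 // ltW.
have d_ge0 k : 0 <= d k by exact: normr_ge0.
have t_ge0 k : 0 <= t k by exact: normr_ge0.
have Kd := kap_d dn.
have K0d : K0 * d n <= kap by have := mulr_ge0 K1_ge0 (d_ge0 n); lra.
have K1d : K1 * d n <= kap by have := mulr_ge0 K0_ge0 (d_ge0 n); lra.
have kt : kap * t n <= kb * w.
  by have := ler_wpM2l kap_ge0 tn; rewrite [leRHS]mulrA.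
have lin := linF Bn; rewrite -/(d n) -/(t n) in lin.
have Kdt := ler_wpM2r (t_ge0 n) Kd.
have TnE : dF (u n) (xd - u n) = - dF (u n) (u n - xd).
  by rewrite -linearN opprB.
have s_le : s <= delta + 2 * (kap * t n).
  have -> : s = `|(yd - F xd) - (F (u n) - F xd - dF xd (u n - xd)) +
      (dF (u n) (u n - xd) - dF xd (u n - xd))|.
    by rewrite /s TnE opprK -residual_split.
  have := T_err (u n - xd) Bn; rewrite -/(t n) -/(d n) => err.
  apply: le_trans (ler_normD _ _) _.
  apply: le_trans (lerD (ler_normB _ _) (lexx _)) _; lra.
have dS_C : d n.+1 <= C * E.
  have sa : s / a n <= (mu + g) * E.
    rewrite ler_pdivrMr // -mulrA -/w.
    have := ler_wpM2r w0 kap_g; rewrite -/kb; lra.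
  apply: le_trans dS _; apply: le_trans (ler_wpM2r E_ge0 CE).
  by rewrite -mulrA ler_wpM2l ?(ltW gam_gt0) //; lra.
have KdS := kap_d dS_C.
have K1dS : K1 * d n.+1 <= kap by have := mulr_ge0 K0_ge0 (d_ge0 n.+1); lra.
have r_le : r <= s + g * w by rewrite /w; lra.
have K1dSt := ler_wpM2r (t_ge0 n) K1dS.
have K0dtS := ler_wpM2r (t_ge0 n.+1) K0d.
have tS : t n.+1 <= 4 * (2 * mu + g) * w.
  have le1 : `|dF (u n) (u n.+1 - xd)| <= s + r.
    have -> : dF (u n) (u n.+1 - xd) = (yd - F (u n) - dF (u n) (xd - u n)) -
        (yd - F (u n) - dF (u n) (u n.+1 - u n)).
      rewrite [- (_ - _ - _)]opprB [RHS]addrC subrKA -linearB.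
      by congr (dF (u n) _); rewrite opprB addrA subrK.
    exact: ler_normB.
  have err := T_err (u n.+1 - xd) Bn; rewrite -/(t n.+1) -/(d n.+1) in err.
  have := ler_distD (dF (u n) (u n.+1 - xd)) (dF xd (u n.+1 - xd)) 0.
  rewrite !subr0 distrC -/(t n.+1) => tri.
  have h1 : t n.+1 * (1 - kap) <= 2 * (2 * mu + g) * w.
    have := ler_wpM2r w0 kap_B; rewrite -/kb; lra.
  have := ler_wpM2l (t_ge0 n.+1) kap_half; lra.
have tS_B : t n.+1 <= B * (E * a n.+1).
  apply: le_trans tS _.
  rewrite BE -(mulrA _ q) ler_wpM2l //; first by rewrite mulr_ge0 //; lra.
  by rewrite mulrCA /w ler_wpM2l // a_slow.
have cS : controlled n.+1 by [].
split=> //.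
have ktS : kap * t n.+1 <= kb * w.
  rewrite /kb -mulrA ler_wpM2l //; apply: le_trans tS_B _.
  by rewrite ler_wpM2l ?(ltW B_gt0) // ler_wpM2l // a_decr.
have linS := linF (controlled_ball cS); rewrite -/(d n.+1) -/(t n.+1) in linS.
have KdtS := ler_wpM2r (t_ge0 n.+1) KdS.
have hE : u n.+1 - u n = (u n.+1 - xd) - (u n - xd) by rewrite opprB addrA subrK.
have err := T_err (u n.+1 - u n) Bn; rewrite -/(t n) in err.
have tt : `|dF xd (u n.+1 - u n)| <= t n.+1 + t n.
  by rewrite hE linearB; exact: ler_normB.
have dd : `|u n.+1 - u n| <= d n.+1 + d n by rewrite hE; exact: ler_normB.
have err' : `|dF (u n) (u n.+1 - u n) - dF xd (u n.+1 - u n)| <=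
    kap * (t n.+1 + t n) + 2 * kap * t n.
  apply: le_trans err _; apply: lerD.
    apply: (ler_pM _ (normr_ge0 _) K0d tt); exact: mulr_ge0.
  have := ler_wpM2l (mulr_ge0 K1_ge0 (t_ge0 n)) dd.
  have := ler_wpM2r (t_ge0 n) K1d; lra.
have -> : res n.+1 = `|((F (u n.+1) - F xd - dF xd (u n.+1 - xd)) -
    (F (u n) - F xd - dF xd (u n - xd))) -
    (dF (u n) (u n.+1 - u n) - dF xd (u n.+1 - u n)) -
    (yd - F (u n) - dF (u n) (u n.+1 - u n))|.
  have -> : dF xd (u n.+1 - u n) = dF xd (u n.+1 - xd) - dF xd (u n - xd).
    by rewrite -linearB -hE.
  by rewrite -residual_telescope.
apply: le_trans (ler_normB _ _) _; rewrite -/r.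
apply: le_trans (lerD (ler_normB _ _) (lexx _)) _.
apply: le_trans (lerD (lerD (ler_normB _ _) (lexx _)) (lexx _)) _.
lra.
Qed.

Lemma controlled_until n : (forall m, (m < n)%N -> delta <= mu * (E * a m)) ->
  controlled n /\ res n <= delta + (g + 8 * kb) * (q * (E * a n)).
Proof.
have w0 k : 0 <= E * a k by rewrite mulr_ge0 // ltW.
have g8 : 0 <= g + 8 * kb by rewrite addr_ge0 ?(ltW g_gt0) // mulr_ge0.
have q0 : 0 <= q - 1 by rewrite subr_ge0.
case: n => [_|n].
  split; first by have [] := controlled0.
  have := res0_le; have := mulr_ge0 g8 (mulr_ge0 q0 (w0 0)).
  by have := mulr_ge0 kb_ge0 (w0 0); lra.
move=> dmu.
have cn : controlled n.
  elim: n dmu => [_|n IHn dmu]; first by have [] := controlled0.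
  have IH : controlled n by apply: IHn => m mn; apply: dmu; exact: ltnW.
  by have [] := controlled_step IH (dmu n (leqnSn n.+1)).
have [cS resS] := controlled_step cn (dmu n (ltnSn n)).
split=> //; apply: le_trans resS _; rewrite lerD2l ler_wpM2l //.
by rewrite mulrCA ler_wpM2l // a_slow.
Qed.

Lemma res_le_tau n : (forall m, (m < n)%N -> delta <= mu * (E * a m)) ->
  mu * (E * a n) <= q * delta -> res n <= tau * delta.
Proof.
move=> dmu mun; have [_ resn] := controlled_until dmu.
apply: le_trans resn _.
have g8 : 0 <= g + 8 * kb by rewrite addr_ge0 ?(ltW g_gt0) // mulr_ge0.
have q0 : 0 <= q by apply: le_trans q_ge1.
have h1 := ler_wpM2l (mulr_ge0 g8 q0) mun.
have h2 := ler_wpM2r (ltW delta_gt0) kap_tau; rewrite -/kb in h2.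
suff : (g + 8 * kb) * (q * (E * a n)) <= (tau - 1) * delta by lra.
by rewrite -(ler_pM2l mu_gt0); lra.
Qed.

(** All three rules stop no later than the first [n] with
    [mu * E * a n <= delta], hence while the iterates are controlled. *)
Lemma stopped_iterate rule N :
  (exists n, mu * (E * a n) <= delta) -> stops rule tau delta res N ->
  [/\ DF (u N), `|u N - xd| <= C * E & res N <= 2 * tau * delta].
Proof.
move=> small; have [nt nt_le nt_min] := ex_minnP small.
have before m : (m < nt)%N -> delta <= mu * (E * a m).
  by move=> mnt; rewrite ltW // ltNge; apply/negP => /nt_min; rewrite leqNgt mnt.
have w0 k : 0 <= E * a k by rewrite mulr_ge0 // ltW.
have res_nt : res nt <= tau * delta.
  apply: res_le_tau before _; apply: le_trans nt_le _.
  by rewrite ler_peMl // ltW.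
have res_pred : res nt.-1 <= tau * delta.
  case E1 : nt => [|k] /=; first by rewrite -E1.
  apply: res_le_tau => [m mk|]; first by apply: before; rewrite E1 ltnS ltnW.
  rewrite E1 in nt_le.
  have q0 : 0 <= q by apply: le_trans q_ge1.
  have := ler_wpM2l (ltW mu_gt0) (ler_wpM2l E_ge0 (a_slow k)).
  by have := ler_wpM2l q0 nt_le; lra.
have td0 : 0 <= tau * delta.
  by rewrite mulr_ge0 ?(ltW delta_gt0) // ltW // (lt_trans ltr01).
have nt_ge2 : ~~ (res 0 <= tau * delta) -> (2 <= nt)%N.
  move=> res0; case: (nt) res_nt res_pred => [|[|k]] //=.
    by move=> h; rewrite h in res0.
  by move=> _ h; rewrite h in res0.
have finish : (N <= nt)%N -> res N <= 2 * tau * delta ->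
    [/\ DF (u N), `|u N - xd| <= C * E & res N <= 2 * tau * delta].
  move=> Nnt resN; have [|[DFN dN _] _] := @controlled_until N => //.
  by move=> m mN; apply: before; exact: leq_trans mN Nnt.
case: rule => /=.
- move=> [resN beforeN]; apply: finish; last by lra.
  by rewrite leqNgt; apply/negP => /beforeN; rewrite ltNge res_nt.
- case: ifPn => [res0 N0|/nt_ge2 nt2 [N1 resN beforeN]].
    by apply: finish; rewrite N0 //; lra.
  apply: finish.
    rewrite leqNgt; apply/negP => ntN; apply: (beforeN nt).
      by rewrite ntN (leq_trans _ nt2).
    by lra.
  have := normr_ge0 (F (u N.-1) - yd); rewrite -/(res N.-1); lra.
- case: ifPn => [res0 N0|/nt_ge2 nt2 [N1 resN beforeN]].
    by apply: finish; rewrite N0 //; lra.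
  apply: finish.
    rewrite leqNgt; apply/negP => ntN; apply: (beforeN nt).
      by rewrite ntN nt2.
    by rewrite ge_max res_nt res_pred.
  by move: resN; rewrite ge_max => /andP[]; lra.
Qed.

End Iteration.

(** * Weak limits of the stopped iterates *)

Section WeakLimit.
Context {R : realType} {X Y : normedModType R}.
Variables (DF : set X) (F : X -> Y) (xd : X) (y : Y) (r rho : R).
Hypotheses (reflX : reflexive_space X) (wcF : weakly_closed DF F)
  (r_rho : r < rho).

(** The norm bound passes to the weak limit through a norming functional. *)
Lemma weak_solution_subseq (v : nat -> X) :
  (forall k, DF (v k)) -> (forall k, `|v k - xd| <= r) ->
  (fun k => F (v k)) @ \oo --> y ->
  exists (phi : nat -> nat) (xs : X),
    [/\ {homo phi : i j / (i < j)%N}, F xs = y, closure (ball xd rho) xs,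
      DF xs & weak_cvg ((fun k => v (phi k)) @ \oo) xs].
Proof.
move=> DFv vr Fv.
have [|phi [xs [phiI vxs]]] := @reflexive_weak_subseq R X v (`|xd| + r) reflX.
  move=> k; have := ler_normD xd (v k - xd); rewrite addrC subrK.
  by have := vr k; lra.
have phi_ge n : (n <= phi n)%N.
  elim: n => // n IHn; apply: leq_ltn_trans IHn _; exact: phiI.
have Fphi : (fun k => F (v (phi k))) @ \oo --> y.
  move=> A /Fv[n _ nA]; exists n => // k /= nk.
  by apply: nA => /=; exact: leq_trans nk (phi_ge k).
have [] := wcF (u := v \o phi) (x := xs) (v := y).
- by move=> k; exact: DFv.
- exact: vxs.
- move=> zeta; apply/cvgrPdist_lt => e e0.
  have z1 : 0 < `|zeta| + 1 by rewrite ltr_wpDl.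
  have /cvgrPdist_lt /(_ (e / (`|zeta| + 1))) := Fphi.
  rewrite divr_gt0 // => /(_ isT); apply: filterS => k /=.
  rewrite ltr_pdivlMr // => lt1; rewrite -dualB.
  apply: le_lt_trans (ler_dual_norm _ _) _; apply: le_lt_trans lt1.
  by rewrite mulrC ler_wpM2l // lerDl.
move=> DFxs Fxs; exists phi, xs; split=> //.
apply: subset_closure; rewrite -ball_normE /= distrC.
have [xi [xi1 xixs]] := norming_functional (xs - xd).
rewrite -xixs; apply: le_lt_trans r_rho.
have cv : (fun k => (xi (v (phi k)) : R) - (xi xd : R)) @ \oo -->
    (xi xs : R) - (xi xd : R).
  by apply: cvgB; [exact: vxs | exact: cvg_cst].
rewrite dualB; apply: (cvgr_to_le cv); apply: nearW => k.
rewrite -dualB; apply: le_trans (ler_norm _) _.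
exact: le_trans (xi1 _) (vr _).
Qed.

End WeakLimit.

Lemma not_near_0_right {R : realType} (P : R -> Prop) :
  ~ (\forall s \near 0^'+, P s) ->
  forall eta : R, 0 < eta -> exists s, 0 < s < eta /\ ~ P s.
Proof.
move=> nP eta eta0; apply: contrapT => /forallNP H; apply: nP.
rewrite /at_right near_withinE; apply/nbhs_ballP; exists eta => //= s.
rewrite -ball_normE /= sub0r normrN => seta s0; apply: contrapT => nPs.
by apply: (H s); split=> //; rewrite s0 -(gtr0_norm s0).
Qed.

(** * The convergence theorem *)

Theorem theorem3p1 (R : realType) (p pstar gam theta tau mu : R)
  (hp : 2 <= p) (hpstar : p^-1 + pstar^-1 = 1) (hgam : 0 < gam)
  (htheta : 1 < theta) (htau : 1 < tau) (hmu : 0 < mu)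
  (hmu_tau : gam `^ (p - 1)^-1 * theta `^ (2 / p) * mu^-1 < (tau - 1) / 2) :
  exists2 eps : R, 0 < eps &
  forall (X Y : completeNormedModType R)
    (Th : X -> \bar R) (alpha : nat -> R)
    (DF : set X) (F : X -> Y) (dF : X -> bounded_op X Y)
    (y : Y) (xd : X) (rho K0 K1 : R)
    (xi0 xid : dual X) (x0 : X) (rule : stopping_rule),
  reflexive_space X ->
  eproper Th -> lower_semicontinuous Th ->
  p_convex Th p -> bregman_const Th p gam ->
  (forall n, 0 < alpha n) ->
  (forall n, 1 <= alpha n / alpha n.+1 <= theta) ->
  alpha @ \oo --> (0 : R) ->
  closed DF -> convex_set (DF : set (convex_lmodType X)) ->
  DF xd -> dom_subdiff Th xd -> F xd = y ->
  0 < rho -> dir_derivable DF F dF xd rho ->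
  `|dF xd| <= alpha 0%N `^ p^-1 / gam ->
  0 <= K0 -> 0 <= K1 -> nonlinearity_cond DF dF xd rho K0 K1 ->
  weakly_closed DF F ->
  unique_minimizer (fun x => restrict_ext Th DF x - (xi0 x : R)%:E)%E x0 ->
  unique_nearest (subdiff (restrict_ext Th DF) xd) xi0 xid ->
  (pstar * gam * mu + 2 * gam `^ (p / (p - 1))) * `|xi0 - xid| `^ (p - 1)^-1
    < rho ->
  (K0 + K1) * `|xi0 - xid| `^ (p - 1)^-1 < eps ->
  (forall (delta : nat -> R) (yd : nat -> Y) (u : nat -> nat -> X)
      (N : nat -> nat),
    (forall k, 0 < delta k) -> (forall k, `|yd k - y| <= delta k) ->
    delta @ \oo --> (0 : R) ->
    (forall k, LM_iteration Th DF F dF p alpha xd rho xi0 x0 (yd k) (u k)) ->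
    (forall k, stops rule tau (delta k) (fun n => `|F (u k n) - yd k|) (N k)) ->
    exists (phi : nat -> nat) (xs : X),
      [/\ {homo phi : i j / (i < j)%N},
          F xs = y, closure (ball xd rho) xs, DF xs &
          weak_cvg ((fun k => u (phi k) (N (phi k))) @ \oo) xs])
  /\
  ((forall x, closure (ball xd rho) x -> DF x -> F x = y -> x = xd) ->
   forall (yd : R -> Y) (u : R -> nat -> X) (N : R -> nat),
    (forall delta, 0 < delta -> `|yd delta - y| <= delta) ->
    (forall delta, 0 < delta ->
      LM_iteration Th DF F dF p alpha xd rho xi0 x0 (yd delta) (u delta)) ->
    (forall delta, 0 < delta ->
      stops rule tau delta (fun n => `|F (u delta n) - yd delta|) (N delta)) ->
    weak_cvg ((fun delta => u delta (N delta)) @ (0 : R)^'+) xd).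
Proof.
pose g := gam `^ (p - 1)^-1; pose q := theta `^ p^-1.
pose B := 4 * (2 * mu + g) * q; pose C := pstar * gam * mu + 2 * gam * g.
have p0 : 0 < p by lra.
have p10 : 0 < p - 1 by lra.
have g0 : 0 < g by exact: powR_gt0.
have q1 : 1 <= q.
  have := ler_powR (ltW htheta); rewrite -[1](powRr0 theta) /q => h.
  by apply: h; rewrite invr_ge0 ltW.
have q0 : 0 < q by lra.
have pstar1 : 1 <= pstar.
  have pV0 : 0 < p^-1 by rewrite invr_gt0.
  have pV1 : p^-1 < 1 by rewrite invf_lt1 //; lra.
  have ps : 0 < pstar^-1 <= 1 by apply/andP; split; lra.
  have /andP[ps0 ps1] := ps; rewrite invr_gt0 in ps0.
  by rewrite -invf_le1.
have gE : gam `^ (p / (p - 1)) = gam * g.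
  have -> : p / (p - 1) = 1 + (p - 1)^-1 by field; rewrite gt_eqF.
  by rewrite powRD ?powRr1 ?(ltW hgam) //; apply/implyP => _; rewrite gt_eqF.
have qE : theta `^ (2 / p) = q ^+ 2.
  by rewrite -powR_mulrn ?powR_ge0 // -powRrM mulrC.
have CE : gam * (mu + 2 * g) <= C.
  have := ler_wpM2r (ltW (mulr_gt0 hgam hmu)) pstar1; rewrite /C; lra.
have C0 : 0 < C.
  by apply: lt_le_trans CE; rewrite mulr_gt0 // addr_gt0 // mulr_gt0.
have B0 : 0 < B by rewrite !mulr_gt0 // addr_gt0 // mulr_gt0.
have q20 : 0 < q ^+ 2 by rewrite exprn_gt0.
rewrite qE in hmu_tau.
have gq : g * q ^+ 2 < mu * ((tau - 1) / 2).
  by rewrite -ltr_pdivrMl // mulrC.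
(* the largest value of the small parameter allowed by the estimates *)
pose kap := Num.min (Num.min 2^-1 ((2 * mu + g) / (5 * B)))
  (Num.min (g / (2 * B)) (mu * (tau - 1) / (16 * B * q ^+ 2))).
have kap0 : 0 < kap.
  have t0 : 0 < tau - 1 by lra.
  have m0 : 0 < 2 * mu + g by lra.
  by rewrite !lt_min invr_gt0 ltr0n /= !divr_gt0 ?mulr_gt0.
have kap1 : kap <= 2^-1 by rewrite !ge_min lexx.
have kap2 : 5 * (kap * B) <= 2 * mu + g.
  have : kap <= (2 * mu + g) / (5 * B) by rewrite !ge_min lexx !orbT.
  by rewrite ler_pdivlMr ?mulr_gt0 //; lra.
have kap3 : 2 * (kap * B) <= g.
  have : kap <= g / (2 * B) by rewrite !ge_min lexx !orbT.
  by rewrite ler_pdivlMr ?mulr_gt0 //; lra.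
have kap4 : (g + 8 * (kap * B)) * q ^+ 2 <= mu * (tau - 1).
  have : kap <= mu * (tau - 1) / (16 * B * q ^+ 2).
    by rewrite !ge_min lexx !orbT.
  by rewrite ler_pdivlMr ?mulr_gt0 //; lra.
exists (kap / C); first by rewrite divr_gt0.
move=> X Y Th alpha DF F dF y xd rho K0 K1 xi0 xid x0 rule reflX pTh lTh cTh bTh.
move=> alpha0 alphaq alphal clDF cDF DFxd dxd Fxd rho0 derF normT K00 K10 nlF wcF.
move=> minx0 near_xid; rewrite gE -/g mulrA -/C => CE_rho KE.
set E := `|xi0 - xid| `^ (p - 1)^-1 in CE_rho KE.
have E0 : 0 <= E by exact: powR_ge0.
have etaE : (g * E) `^ (p - 1) = gam * `|xi0 - xid|.
  have ge0 : 0 <= gam * `|xi0 - xid| by rewrite mulr_ge0 // ltW.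
  by rewrite -powRM ?(ltW hgam) // -powRrM mulVf ?gt_eqF // powRr1.
pose a n := alpha n `^ p^-1.
have a0 n : 0 < a n by exact: powR_gt0.
have aE n : a n `^ p = alpha n.
  by rewrite -powRrM mulVf ?gt_eqF // powRr1 // ltW.
have pV0 : 0 <= p^-1 by rewrite invr_ge0 ltW.
have a_decr n : a n.+1 <= a n.
  have /andP[+ _] := alphaq n; rewrite ler_pdivlMr // mul1r => le1.
  by apply: ge0_ler_powR => //; rewrite nnegrE ltW.
have a_slow n : a n <= q * a n.+1.
  have /andP[_] := alphaq n; rewrite ler_pdivrMr // => le1.
  have th0 : 0 < theta by lra.
  rewrite /q /a -powRM ?(ltW th0) ?(ltW (alpha0 _)) //.
  by apply: ge0_ler_powR => //; rewrite nnegrE ?mulr_ge0 // ltW.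
have kapE : (K0 + K1) * (C * E) <= kap.
  by rewrite mulrCA mulrC -ler_pdivlMr // ltW.
have [dxd1 _] := dxd.
have dom_xd : edom (restrict_ext Th DF) xd by exact/edom_restrict.
have dom_x0 : edom (restrict_ext Th DF) x0.
  have [/(_ xd) + _] := minx0; rewrite (restrict_in _ DFxd) (edom_fine pTh dxd1).
  move=> le1; rewrite /edom /= ltNge leye_eq; apply/negP => /eqP Tx0.
  by move: le1; rewrite Tx0 addye.
have [[sxid _] _] := near_xid.
have breg := bregman_restrict_ge p0 hgam pTh lTh cTh bTh dxd cDF dom_xd.
have linF := linearization_error cDF DFxd rho0 derF K00 K10 nlF.
have small delta : 0 < delta -> exists n, mu * (E * a n) <= delta.
  move=> delta0.
  have muE : 0 < mu * E + 1 by rewrite ltr_wpDl // mulr_ge0 // ltW.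
  have d1 : 0 < (delta / (mu * E + 1)) `^ p by rewrite powR_gt0 // divr_gt0.
  have /cvgrPdist_lt /(_ _ d1) [n _ /(_ n (leqnn n))] := alphal.
  rewrite /= sub0r normrN gtr0_norm // => an; exists n.
  have : a n <= delta / (mu * E + 1).
    rewrite leNgt; apply/negP => lt1.
    have := gt0_ltr_powR p0 _ _ lt1; rewrite !nnegrE (ltW (a0 n)) aE.
    by rewrite divr_ge0 ?ltW // => /(_ isT isT); rewrite ltNge ltW.
  by rewrite ler_pdivlMr //; have := a0 n; lra.
(* the estimates at the stopping index, uniform in the noise level *)
have stopped (delta : R) (yd : Y) (u : nat -> X) (N : nat) :
    0 < delta -> `|yd - y| <= delta ->
    LM_iteration Th DF F dF p alpha xd rho xi0 x0 yd u ->
    stops rule tau delta (fun n => `|F (u n) - yd|) N ->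
    [/\ DF (u N), `|u N - xd| <= C * E & `|F (u N) - y| <= (2 * tau + 1) * delta].
  move=> delta0 ydd uLM stopN; rewrite -Fxd in ydd.
  have [] := stopped_iterate (N := N) hp hgam hmu htau E0 g0 q1 K00 K10 etaE a0 aE a_decr
    a_slow CE CE_rho (erefl B) kapE kap1 kap2 kap3 kap4 pTh dom_xd dom_x0
    (fun z dz => breg z xid dz sxid) minx0 normT nlF linF delta0 ydd uLM
    (rule := rule) (small _ delta0) stopN.
  move=> DFN dN resN; split=> //.
  have := ler_distD yd (F (u N)) y; rewrite -Fxd; lra.
have tau0 : 0 < 2 * tau + 1 by lra.
have subseq (delta : nat -> R) (yd : nat -> Y) (u : nat -> nat -> X)
      (N : nat -> nat) :
    (forall k, 0 < delta k) -> (forall k, `|yd k - y| <= delta k) ->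
    delta @ \oo --> (0 : R) ->
    (forall k, LM_iteration Th DF F dF p alpha xd rho xi0 x0 (yd k) (u k)) ->
    (forall k, stops rule tau (delta k) (fun n => `|F (u k n) - yd k|) (N k)) ->
    exists (phi : nat -> nat) (xs : X),
      [/\ {homo phi : i j / (i < j)%N},
          F xs = y, closure (ball xd rho) xs, DF xs &
          weak_cvg ((fun k => u (phi k) (N (phi k))) @ \oo) xs].
  move=> delta0 ydd deltal uLM stopN.
  have st k := stopped _ _ _ _ (delta0 k) (ydd k) (uLM k) (stopN k).
  apply: (weak_solution_subseq reflX wcF CE_rho (v := fun k => u k (N k))).
  - by move=> k; have [] := st k.
  - by move=> k; have [] := st k.
  apply/cvgrPdist_lt => e e0.
  have /cvgrPdist_lt /(_ (e / (2 * tau + 1))) := deltal.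
  rewrite divr_gt0 // => /(_ isT); apply: filterS => k.
  rewrite sub0r normrN gtr0_norm // ltr_pdivlMr // => lt1.
  rewrite distrC; have [_ _ le1] := st k; apply: le_lt_trans le1 _.
  by rewrite mulrC.
split; first exact: subseq.
(* otherwise some sequence of noise levels would keep a functional away from
   its value at [xd], against the first part *)
move=> uniq yd u N ydd uLM stopN xi; apply/cvgrPdist_lt => e e0.
apply: contrapT => /not_near_0_right far.
have /choice[delta deltaP] : forall k : nat, exists s : R,
    0 < s < k.+1%:R^-1 /\ e <= `|(xi xd : R) - (xi (u s (N s)) : R)|.
  move=> k; have [|s [s0 /negP]] := far k.+1%:R^-1.
    by rewrite invr_gt0 ltr0n.
  by rewrite -leNgt => es; exists s.
have delta0 k : 0 < delta k by have [/andP[]] := deltaP k.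
have deltal : delta @ \oo --> (0 : R).
  apply/cvgrPdist_lt => d d0; have := near_infty_natSinv_lt (PosNum d0).
  apply: filterS => k; rewrite sub0r normrN gtr0_norm //.
  by have [/andP[_ + _]] := deltaP k; exact: lt_trans.
have [phi [xs [phiI Fxs clxs DFxs cvxs]]] := subseq delta (yd \o delta)
  (u \o delta) (N \o delta) delta0 (fun k => ydd _ (delta0 k)) deltal
  (fun k => uLM _ (delta0 k)) (fun k => stopN _ (delta0 k)).
have xsE := uniq xs clxs DFxs Fxs; rewrite xsE in cvxs.
have cvxi : (fun k => xi (u (delta (phi k)) (N (delta (phi k)))) : R) @ \oo -->
    (xi xd : R) by exact: cvxs.
have /cvgrPdist_lt /(_ e e0) /filter_ex[k] := cvxi.
by rewrite ltNge => /negP; apply; have [] := deltaP (phi k).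
Qed.
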